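(* Let $p$ be a fixed constant. There is a polynomial-time algorithm that decides, for a given graph $G=(V,E)$ whose largest induced matching has size at most $p$, whether $G$ is a unique key graph.
   Context: An induced matching of $G$ is a set of edges no two of which share an endpoint or are joined by an edge of $G$. A pure Horn clause $A\to v$ ($A\subseteq V$, $v\in V$) stands for $v\vee\bigvee_{a\in A}\bar a$; a Boolean function $h:\{0,1\}^V\to\{0,1\}$ is pure Horn if it is a conjunction of such clauses; $A\to v$ is an implicate of $h$ if every true point of $h$ satisfies it; $K\subseteq V$ is a key of $h$ if $K\to w$ is an implicate for all $w\in V\setminus K$; $\mathcal{K}(h)$ is the family of minimal keys. A Sperner hypergraph $\mathcal{B}\subseteq 2^V$ is a unique key hypergraph if there is exactly one pure Horn function $h$ on $V$ with $\mathcal{K}(h)=\mathcal{B}$. A graph $G=(V,E)$ is a unique key graph if $E$, viewed as a hypergraph of $2$-element subsets of $V$, is a unique key hypergraph. *)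

(* Defs.v *)
From mathcomp Require Import all_boot.

Set Implicit Arguments.
Unset Strict Implicit.
Unset Printing Implicit Defensive.

Section PureHorn.
Variable V : finType.

Definition point := {ffun V -> bool}.
Definition boolfun := {ffun point -> bool}.

(* The pair (A, v) is the clause A -> v. *)
Definition clause := ({set V} * V)%type.

Definition clause_sat (c : clause) (x : point) : bool :=
  x c.2 || [exists a in c.1, ~~ x a].

Definition pure_horn (h : boolfun) : Prop :=
  exists C : {set clause}, forall x, h x = [forall c in C, clause_sat c x].

Definition implicate (h : boolfun) (c : clause) : bool :=
  [forall x, h x ==> clause_sat c x].

Definition is_key (h : boolfun) (K : {set V}) : bool :=
  [forall w in ~: K, implicate h (K, w)].

Definition minimal_keys (h : boolfun) : {set {set V}} :=
  [set K | minset (is_key h) K].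

Definition sperner (B : {set {set V}}) : Prop :=
  forall A1 A2, A1 \in B -> A2 \in B -> A1 \subset A2 -> A1 = A2.

Definition unique_key_hypergraph (B : {set {set V}}) : Prop :=
  sperner B /\ exists! h : boolfun, pure_horn h /\ minimal_keys h = B.

End PureHorn.

Record graph := Graph {
  vertex : finType;
  adj : rel vertex;
  adj_sym : symmetric adj;
  adj_irr : irreflexive adj
}.

Definition edges (G : graph) : {set {set vertex G}} :=
  [set [set x; y] | x in vertex G, y in vertex G & adj x y].

Definition unique_key_graph (G : graph) : Prop :=
  unique_key_hypergraph (edges G).

Definition induced_matching (G : graph) (M : {set {set vertex G}}) : bool :=
  (M \subset edges G) &&
  [forall e in M, forall f in M, (e != f) ==>
     [disjoint e & f] && [forall x in e, forall y in f, ~~ adj x y]].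

Definition max_induced_matching (G : graph) : nat :=
  \max_(M : {set {set vertex G}} | induced_matching M) #|M|.

(* The number of vertices in unary, a separator, and the adjacency matrix row
   by row. *)
Definition encode_graph (G : graph) : seq bool :=
  nseq #|vertex G| true ++
  false :: [seq adj x y | x <- enum (vertex G), y <- enum (vertex G)].

Inductive move := MoveLeft | MoveRight | Stay.

(* Deterministic Turing machines with one or more tapes; tape 0 is the input
   tape. *)
Record turing_machine := TuringMachine {
  tm_extra_tapes : nat;
  tm_symbol : finType;
  tm_blank : tm_symbol;
  tm_bit : bool -> tm_symbol;
  tm_symbols_uniq : uniq [:: tm_blank; tm_bit false; tm_bit true];
  tm_state : finType;
  tm_start : tm_state;
  tm_accept : tm_state;
  tm_reject : tm_state;
  tm_accept_reject : tm_accept != tm_reject;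
  tm_trans : tm_state -> {ffun 'I_tm_extra_tapes.+1 -> tm_symbol} ->
             tm_state * {ffun 'I_tm_extra_tapes.+1 -> tm_symbol * move}
}.

Section Run.
Variable M : turing_machine.

(* A two-way infinite tape: tape_left and tape_right list the cells on either
   side of the head, nearest first; all cells beyond them are blank. *)
Record tape := Tape {
  tape_left : seq (tm_symbol M);
  tape_head : tm_symbol M;
  tape_right : seq (tm_symbol M)
}.

Definition tape_of (s : seq (tm_symbol M)) : tape :=
  Tape [::] (head (tm_blank M) s) (behead s).

Definition tape_update (t : tape) (a : tm_symbol M * move) : tape :=
  let: Tape l _ r := t in
  let: (b, m) := a in
  match m with
  | MoveLeft => Tape (behead l) (head (tm_blank M) l) (b :: r)
  | MoveRight => Tape (b :: l) (head (tm_blank M) r) (behead r)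
  | Stay => Tape l b r
  end.

Definition config : Type :=
  (tm_state M * {ffun 'I_(tm_extra_tapes M).+1 -> tape})%type.

Definition init_config (w : seq bool) : config :=
  (tm_start M,
   [ffun i => tape_of (if i == ord0 then map (@tm_bit M) w else [::])]).

Definition step (c : config) : config :=
  let: (q, ts) := c in
  if (q == tm_accept M) || (q == tm_reject M) then c else
  let: (q', a) := tm_trans q [ffun i => tape_head (ts i)] in
  (q', [ffun i => tape_update (ts i) (a i)]).

(* Halting configurations are fixed by step, so "within t steps" is "after
   exactly t iterations". *)
Definition answers_within (w : seq bool) (t : nat) (b : bool) : Prop :=
  (iter t step (init_config w)).1 = if b then tm_accept M else tm_reject M.

End Run.

(* A polynomial-time decision procedure for P on the instances satisfying the
   promise D; its behaviour on other inputs is unconstrained. *)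
Definition polytime_decidable (X : Type) (enc : X -> seq bool)
    (D P : X -> Prop) : Prop :=
  exists (M : turing_machine) (c d : nat), forall x, D x ->
    exists b : bool,
      answers_within M (enc x) (c * size (enc x) ^ d + c) b /\ (b <-> P x).

(* Main.v *)
Require Import Defs.
From mathcomp Require Import all_boot.
From mathcomp Require Import zify.
From Stdlib Require Import FunctionalExtensionality.

Set Implicit Arguments.
Unset Strict Implicit.
Unset Printing Implicit Defensive.

(* If G has an edge, the pure Horn functions with minimal keys E correspond to
   the intersection-closed families consisting of V, of all maximal independent
   sets, and of some further independent sets.  Hence G is a unique key graph
   iff no independent set outside N[v] dominates N(v), for any vertex v.

   Such a dominating set may be taken to be a maximal independent set J of
   G - N[v].  Fix an order of the vertices.  The greedy algorithm outside N[v]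
   finds J unless it meets some w outside J before the first neighbour u of w
   in J.  Choose such a pair (u, w) with u as late as possible, and forbid the
   neighbours of u and of w that come before u: J is not affected, and the
   remaining errors come before u and only involve vertices that are neither
   equal nor adjacent to u and w.  So the edges uw chosen in this way form an
   induced matching, and at most p corrections are needed.  It is enough to run
   the greedy algorithm for every v and every p-tuple of pairs.

   The Turing machine is compiled from a language with bit arrays, adjacency
   queries and loops over all vertices: loop variables are head positions on
   tapes of length n, so every program runs in polynomial time. *)

(** * Unique key graphs *)

Section HornFunctions.
Variable V : finType.
Implicit Types (h : boolfun V) (K : {set V}) (x : point V).

(** Points are handled as vertex sets: the clause [A -> v] holds at a set that contains [v] or does
    not contain [A]. *)
Definition indicator K : point V := [ffun a => a \in K].

Lemma clause_satP (c : clause V) K :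
  reflect (c.1 \subset K -> c.2 \in K) (clause_sat c (indicator K)).
Proof.
rewrite /clause_sat ffunE; apply: (iffP orP) => [[//|/existsP[a /andP[Ha]]]|H].
  by rewrite ffunE => HaK /subsetP/(_ a Ha); rewrite (negbTE HaK).
have [sub|/subsetPn[a Ha HaK]] := boolP (c.1 \subset K); first by left; apply: H.
by right; apply/existsP; exists a; rewrite Ha ffunE.
Qed.

Lemma indicatorE x : x = indicator [set a | x a].
Proof. by apply/ffunP => a; rewrite ffunE inE. Qed.

(** A clause [K -> w] fails exactly at a true set that contains [K] and misses [w]. *)
Lemma is_keyP h K :
  reflect (forall S, h (indicator S) -> K \subset S -> S = setT) (is_key h K).
Proof.
apply: (iffP forallP) => [H S hS sub|H w].
  apply/eqP; rewrite -subTset; apply/subsetP => w _.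
  have [/(subsetP sub) //|Hw] := boolP (w \in K).
  have := H w; rewrite inE Hw /= => /forallP/(_ (indicator S)).
  by rewrite hS => /clause_satP /= ->.
apply/implyP => _; apply/forallP => x; apply/implyP; rewrite [x]indicatorE => hx.
by apply/clause_satP => /= sub; rewrite (H _ hx sub) inE.
Qed.

Lemma not_key h K : ~~ is_key h K ->
  exists S, [/\ h (indicator S), K \subset S & S != setT].
Proof.
case/forallPn => w; rewrite negb_imply inE => /andP[wK /forallPn[x]].
rewrite negb_imply [x]indicatorE => /andP[hx /clause_satP nsat].
have [sub|nsub] := boolP (K \subset [set a | x a]); last by case: nsat => /= sub;
    rewrite sub in nsub.
exists [set a | x a]; split=> //; apply/eqP => E; case: nsat => /= _.
by rewrite E inE.
Qed.

Lemma is_key_sub h K (L : {set V}) : K \subset L -> is_key h K -> is_key h L.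
Proof.
move=> sub /is_keyP H; apply/is_keyP => S hS LS; apply: H hS _.
exact: subset_trans LS.
Qed.

(** Keys are closed upwards, so the minimal ones determine all of them. Conversely, the Sperner
    condition makes each member of [B] minimal among the sets that contain a member. *)
Lemma keys_of_minimal h (B : {set {set V}}) : sperner B ->
  minimal_keys h = B <-> (forall K, is_key h K = [exists e in B, e \subset K]).
Proof.
move=> spB; split=> [EB K|HB].
  apply/idP/existsP => [HK|[e /andP[He sub]]].
    have [e me sub] := minset_exists HK.
    by exists e; rewrite -EB inE me sub.
  by move: He; rewrite -EB inE => /minsetp/(is_key_sub sub).
apply/setP => K; rewrite inE; apply/minsetP/idP => [[]|HK].
  rewrite HB => /existsP[e /andP[He sub]] /(_ e) <- //.
  by rewrite HB; apply/existsP; exists e; rewrite He /=.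
split=> [|L]; first by rewrite HB; apply/existsP; exists K; rewrite HK /=.
rewrite HB => /existsP[e /andP[He eL]] LK.
have eK := spB _ _ He HK (subset_trans eL LK).
by apply/eqP; rewrite eqEsubset LK -eK.
Qed.

End HornFunctions.

Section UniqueKey.
Variable G : graph.
Let V := vertex G.
Implicit Types (x y v w : V) (S I : {set V}).

Lemma in_edges (e : {set V}) :
  reflect (exists x y, adj x y /\ e = [set x; y]) (e \in edges G).
Proof.
apply: (iffP imset2P) => [[x y _]|[x [y [xy ->]]]].
  by rewrite !inE /= => xy ->; exists x, y.
by exists x y => //; rewrite !inE.
Qed.

Definition independent I : bool := [forall x in I, forall y in I, ~~ adj x y].

Lemma independentP I :
  reflect (forall x y, x \in I -> y \in I -> ~~ adj x y) (independent I).
Proof.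
apply: (iffP forallP) => [H x y Hx Hy|H x].
  by have := H x; rewrite Hx /= => /forallP/(_ y); rewrite Hy.
by apply/implyP => Hx; apply/forallP => y; apply/implyP; apply: H.
Qed.

Lemma independent_no_edge I : independent I = ~~ [exists e in edges G, e \subset I].
Proof.
apply/independentP/existsPn => [H e|H x y Hx Hy].
  apply/negP => /andP[/in_edges[x [y [xy ->]]]].
  by rewrite subUset !sub1set => /andP[Hx Hy]; have := H x y Hx Hy; rewrite xy.
apply/negP => xy; have He : [set x; y] \in edges G by apply/in_edges; exists x, y.
by have := H [set x; y]; rewrite He subUset !sub1set Hx Hy.
Qed.

Lemma sperner_edges : sperner (edges G).
Proof.
move=> e1 e2 /in_edges[x [y [xy ->]]] /in_edges[z [t [zt ->]]] sub.
have ne a b : @adj G a b -> a != b.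
  by apply: contraTneq => ->; rewrite adj_irr.
by apply/eqP; rewrite eqEcard sub !cards2 !ne.
Qed.

(** The obstruction to uniqueness: [I -> v] can then be added to the edge clauses without changing
    the keys. *)
Definition dominator v I : Prop :=
  [/\ independent I, v \notin I, forall x, x \in I -> ~~ adj v x &
      forall w, adj v w -> exists2 x, x \in I & adj w x].

(** These clauses define the function with the most true sets that can have the edges as its minimal
    keys: [V] and all independent sets are true. *)
Definition edge_clauses : {set clause V} := [set c | c.1 \in edges G].
Definition horn (C : {set clause V}) : boolfun V :=
  [ffun x => [forall c in C, clause_sat c x]].

Lemma pure_horn_horn (C : {set clause V}) : pure_horn (horn C).
Proof. by exists C => x; rewrite ffunE. Qed.

Lemma hornP (C : {set clause V}) S :
  reflect (forall c, c \in C -> c.1 \subset S -> c.2 \in S) (horn C (indicator S)).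
Proof.
rewrite ffunE; apply: (iffP forallP) => [H c Hc|H c].
  by apply/clause_satP; have := H c; rewrite Hc.
by apply/implyP => Hc; apply/clause_satP; apply: H.
Qed.

Lemma horn_edgesP S : reflect (independent S \/ S = setT) (horn edge_clauses (indicator S)).
Proof.
apply: (iffP (hornP _ _)) => [H|[iS|->] c]; last by rewrite inE.
  have [|] := boolP (independent S); first by left.
  rewrite independent_no_edge negbK => /existsP[e /andP[He sub]]; right.
  by apply/setP => v; rewrite inE; apply: (H (e, v)) => //; rewrite inE.
rewrite inE => He sub; move: iS; rewrite independent_no_edge => /existsP[].
by exists c.1; rewrite He.
Qed.

(** By the first hypothesis a true set containing an edge is [V], so supersets of edges are keys. By
    the second an independent set lies in a proper true set, so it is not a key. *)
Lemma is_key_edge (h : boolfun V) K :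
  (forall S, h (indicator S) -> independent S \/ S = setT) ->
  (forall S, independent S -> S != setT ->
      exists T : {set V}, [/\ S \subset T, T != setT & h (indicator T)]) ->
  ~~ independent [set: V] ->
  is_key h K = [exists e in edges G, e \subset K].
Proof.
move=> H1 H2 HT; rewrite -[RHS]negbK -independent_no_edge.
apply/is_keyP/idP => [H|nK S hS KS].
  apply/negP => iK; have [|T [KT nT hT]] := H2 K iK.
    by apply: contraNneq HT => <-.
  by rewrite (H T hT KT) eqxx in nT.
have [/independentP iS|//] := H1 S hS; case/negP: nK; apply/independentP => x y Hx Hy.
by apply: iS; apply: (subsetP KS).
Qed.

Lemma horn_setT h : pure_horn h -> h (indicator [set: V]).
Proof.
by move=> [C HC]; rewrite HC; apply/forallP => c; apply/implyP => _; apply/clause_satP;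
    rewrite inE.
Qed.

(** [0 < #|V|] excludes the empty graph, where the empty set is a key of every function although
    there is no edge. In a nonempty edgeless graph the empty set is a dominator of every vertex. *)
Lemma unique_key_graphP :
  unique_key_graph G <-> 0 < #|V| /\ forall v I, ~ dominator v I.
Proof.
have key_edge h (Hh : minimal_keys h = edges G) K : is_key h K = ~~ independent K.
  by have [/(_ Hh) -> _] := keys_of_minimal h sperner_edges; rewrite independent_no_edge negbK.
split=> [[_ [h0 [[ph0 Hh0] uni]]]|[V0 noI]].
  have HT : ~~ independent [set: V].
    by rewrite -(key_edge _ Hh0); apply/is_keyP => S _; rewrite subTset => /eqP.
  split.
    rewrite lt0n; apply: contraNneq HT => /card0_eq V0.
    by apply/independentP => x; have := V0 x; rewrite inE.
  move=> v I [iI vI nI dI].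
  have key0 : minimal_keys (horn edge_clauses) = edges G.
    apply/(keys_of_minimal _ sperner_edges) => K.
    apply: is_key_edge => //.
      by move=> S /horn_edgesP.
    by move=> S iS nS; exists S; split=> //; apply/horn_edgesP; left.
  (* An independent [S] containing [I] has no neighbour [w] of [v], as [w] has a neighbour in [I].
     So [v |: S] is independent and satisfies the new clause; if [S] does not contain [I], it is
     true itself. *)
  have key1 : minimal_keys (horn ((I, v) |: edge_clauses)) = edges G.
    apply/(keys_of_minimal _ sperner_edges) => K.
    apply: is_key_edge => //.
      move=> S /hornP H; apply/horn_edgesP/hornP => c Hc; apply: H.
      by rewrite inE Hc orbT.
    move=> S /independentP iS nS.
    have [IS|nIS] := boolP (I \subset S); last first.
      exists S; split=> //; apply/hornP => c /setU1P[->|Hc] /=.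
        by move=> IS; rewrite IS in nIS.
      by move: c Hc; apply/hornP/horn_edgesP; left; apply/independentP.
    have nv w : w \in S -> ~~ adj v w.
      move=> wS; apply/negP => /dI[x Hx wx].
      by have := iS _ _ wS (subsetP IS x Hx); rewrite wx.
    have ivS : independent (v |: S).
      apply/independentP => x y /setU1P[->|Hx] /setU1P[->|Hy]; rewrite ?adj_irr ?nv //.
        by rewrite adj_sym nv.
      exact: iS.
    exists (v |: S); split; first exact: subsetUr.
      by apply: contraNneq HT => <-.
    apply/hornP => c /setU1P[->|Hc] /=; first by rewrite setU11.
    by move: c Hc; apply/hornP/horn_edgesP; left.
  (* Uniqueness identifies the two functions, but [I] is a true set of the first and not of the
     second. *)
  have E : horn edge_clauses = horn ((I, v) |: edge_clauses).
    by rewrite -(uni _ (conj (pure_horn_horn _) key0)) -(uni _ (conj (pure_horn_horn _) key1)).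
  have : horn edge_clauses (indicator I) by apply/horn_edgesP; left.
  rewrite E => /hornP/(_ (I, v)); rewrite setU11 => /(_ isT (subxx I)) /=.
  by move/negP: vI.
have HT : ~~ independent [set: V].
  have /card_gt0P[v _] : 0 < #|[set: V]| by rewrite cardsT.
  apply/negP => /independentP iT; apply: (noI v set0); split; rewrite ?inE //.
  - by apply/independentP => x; rewrite inE.
  - by move=> x; rewrite inE.
  by move=> w vw; have := iT v w; rewrite !inE vw => /(_ isT isT).
split; first exact: sperner_edges.
exists (horn edge_clauses); split.
  split; first exact: pure_horn_horn.
  apply/(keys_of_minimal _ sperner_edges) => K.
  apply: is_key_edge => //.
    by move=> S /horn_edgesP.
  by move=> S iS nS; exists S; split=> //; apply/horn_edgesP; left.
move=> h [ph Hh]; apply/ffunP => x; rewrite [x]indicatorE; set S := [set a | x a].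
have true_indep T : h (indicator T) -> independent T \/ T = setT.
  move=> hT; have [|nT] := boolP (independent T); first by left.
  by right; move: nT; rewrite -(key_edge _ Hh) => /is_keyP; apply.
(* An independent set is not a key, so it lies in a proper true set, which is independent again. *)
have extend T : independent T ->
    exists T' : {set V}, [/\ T \subset T', independent T' & h (indicator T')].
  move=> iT; have := key_edge _ Hh T; rewrite iT => /negbT/not_key[T' [hT' TT' nT']].
  by exists T'; split=> //; have [|E] := true_indep T' hT'; last by rewrite E eqxx in nT'.
apply/horn_edgesP/idP => [[iS|->]|/true_indep //]; last exact: horn_setT.
(* If the independent set [S] is not true, it violates some clause [L -> v], and [v] belongs to
   every true set containing [S]. Then [S] is a dominator of [v]. *)
have [C HC] := ph; rewrite HC; apply/forallP => -[L v]; apply/implyP => Hc.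
apply/clause_satP => /= LS; apply/negPn/negP => vS.
have closed T : h (indicator T) -> S \subset T -> v \in T.
  rewrite HC => /forallP/(_ (L, v)); rewrite Hc => /clause_satP /= H ST.
  exact: H (subset_trans LS ST).
have [T [ST /independentP iT hT]] := extend S iS; have vT := closed T hT ST.
apply: (noI v S); split=> // [z zS|w vw]; first by apply: iT vT (subsetP ST z zS).
(* Otherwise [w |: S] is independent and extends to a true independent set, which contains the
   adjacent vertices [v] and [w]. *)
apply/exists_inP; apply: contraT => /exists_inPn nw.
have iwS : independent (w |: S).
  move/independentP: iS => iS; apply/independentP => y z /setU1P[->|Hy] /setU1P[->|Hz];
      rewrite ?adj_irr ?nw //.
    by rewrite adj_sym nw.
  exact: iS.
have [T' [ST' /independentP iT' hT']] := extend _ iwS.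
have vT' := closed T' hT' (subset_trans (subsetUr _ _) ST').
have wT' : w \in T' by apply: (subsetP ST'); rewrite setU11.
by have := iT' _ _ vT' wT'; rewrite vw.
Qed.

End UniqueKey.

(** * Tape programs and Turing machines *)

(* The components are a data bit and the end marks "leftmost cell" and
   "rightmost cell"; on the input tape the third component only serves to
   distinguish the bit 0 from a blank. *)
Definition sym := (bool * bool * bool)%type.
Definition blank : sym := (false, false, false).
Definition bit_sym (b : bool) : sym := (b, false, true).
Definition data (a : sym) : bool := a.1.1.
Definition leftmost (a : sym) : bool := a.1.2.
Definition rightmost (a : sym) : bool := a.2.

Definition shift (m : move) (c i : nat) : nat :=
  match m with MoveLeft => i - c | MoveRight => i + c | Stay => i end.

Section TapePrograms.
Variable K : finType.

Inductive tprog :=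
| Move of (K -> move)
| Write of ((K -> sym) -> K -> sym)
| TSeq of tprog & tprog
| TIf of ((K -> sym) -> bool) & tprog & tprog
| While of ((K -> sym) -> bool) & tprog.

Definition tstate := ((K -> nat -> sym) * (K -> nat))%type.

Definition heads (s : tstate) (k : K) : sym := s.1 k (s.2 k).

Definition put (s : tstate) (w : K -> sym) (k : K) (i : nat) : sym :=
  if i == s.2 k then w k else s.1 k i.

Definition shifts (mv : K -> move) (c : nat) (P : K -> nat) (k : K) : nat :=
  shift (mv k) c (P k).

(* Cells are numbered from 0, so heads never move left of cell 0.  The number
   is an upper bound on the running time. *)
Inductive exec : tprog -> tstate -> nat -> tstate -> Prop :=
| exec_move mv s t :
    (forall k, mv k = MoveLeft -> 0 < s.2 k) -> 0 < t ->
    exec (Move mv) s t (s.1, shifts mv 1 s.2)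
| exec_write w s t :
    0 < t -> exec (Write w) s t (put s (w (heads s)), s.2)
| exec_seq p q s1 t1 s2 t2 s3 t :
    exec p s1 t1 s2 -> exec q s2 t2 s3 -> t1 + t2 <= t ->
    exec (TSeq p q) s1 t s3
| exec_if (b : (K -> sym) -> bool) p q s t1 s' t :
    exec (if b (heads s) then p else q) s t1 s' -> t1 < t ->
    exec (TIf b p q) s t s'
| exec_while_end (b : (K -> sym) -> bool) p s t : ~~ b (heads s) -> 0 < t ->
    exec (While b p) s t s
| exec_while (b : (K -> sym) -> bool) p s1 t1 s2 t2 s3 t :
    b (heads s1) -> exec p s1 t1 s2 -> exec (While b p) s2 t2 s3 ->
    t1 + t2 < t -> exec (While b p) s1 t s3.

Lemma exec_le p s t s' u : exec p s t s' -> t <= u -> exec p s u s'.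
Proof.
case=> {p s t s'}.
- by move=> mv s t Hs Ht Hu; apply: exec_move => //; lia.
- by move=> w s t Ht Hu; apply: exec_write; lia.
- by move=> p q s1 t1 s2 t2 s3 t H1 H2 Ht Hu; apply: exec_seq H1 H2 _; lia.
- by move=> b p q s t1 s' t H Ht Hu; apply: exec_if H _; lia.
- by move=> b p s t Hb Ht Hu; apply: exec_while_end; last lia.
by move=> b p s1 t1 s2 t2 s3 t Hb H1 H2 Ht Hu; apply: exec_while Hb H1 H2 _; lia.
Qed.

(** Each of the [c] rounds costs one test and one move, and a last test ends the loop. *)
Lemma exec_scan (b : (K -> sym) -> bool) mv c s t :
  (forall j, j < c -> b (heads (s.1, shifts mv j s.2))) ->
  ~~ b (heads (s.1, shifts mv c s.2)) ->
  (forall k, mv k = MoveLeft -> c <= s.2 k) ->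
  2 * c < t -> exec (While b (Move mv)) s t (s.1, shifts mv c s.2).
Proof.
elim: c s t => [|c IH] [F P] t /= Hb Hc Hl Ht.
  have E : shifts mv 0 P = P.
    by apply: functional_extensionality => k; rewrite /shifts /shift; case: (mv k); lia.
  by rewrite E in Hc *; apply: exec_while_end => //; lia.
have E j : shifts mv j (shifts mv 1 P) = shifts mv j.+1 P.
  by apply: functional_extensionality => k; rewrite /shifts /shift; case: (mv k); lia.
have E0 : shifts mv 0 P = P.
  by apply: functional_extensionality => k; rewrite /shifts /shift; case: (mv k); lia.
apply: (exec_while (t1 := 1) (s2 := (F, shifts mv 1 P)) (t2 := t - 2)); last lia.
- by have := Hb 0 isT; rewrite E0.
- by apply: (@exec_move mv (F, P)) => //= k /Hl; lia.
rewrite -(E c); apply: (IH (F, shifts mv 1 P)); last lia.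
- by move=> j Hj /=; rewrite E; apply: Hb.
- by rewrite /= E.
by move=> k Hk; have := Hl k Hk; rewrite /= /shifts Hk /=; lia.
Qed.

(** For a conditional or a loop, [None] is the state in which the test is evaluated. *)
Fixpoint pstate (p : tprog) : finType :=
  match p with
  | Move _ | Write _ => unit
  | TSeq p q => (pstate p + pstate q)%type
  | TIf _ p q => option (pstate p + pstate q)
  | While _ p => option (pstate p)
  end.

Fixpoint entry (p : tprog) : pstate p :=
  match p with
  | Move _ | Write _ => tt
  | TSeq p q => inl (entry p)
  | TIf _ p q => None
  | While _ p => None
  end.

Definition keep (h : K -> sym) (k : K) : sym * move := (h k, Stay).

(* The next state None means that the program has been left. *)
Fixpoint delta (p : tprog) :
    pstate p -> (K -> sym) -> option (pstate p) * (K -> sym * move) :=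
  match p with
  | Move mv => fun _ h => (None, fun k => (h k, mv k))
  | Write w => fun _ h => (None, fun k => (w h k, Stay))
  | TSeq p q => fun a h =>
      match a with
      | inl a => let d := delta a h in
          (Some (if d.1 is Some b then inl b else inr (entry q)), d.2)
      | inr a => let d := delta a h in (omap inr d.1, d.2)
      end
  | TIf b p q => fun a h =>
      match a with
      | None => (Some (Some (if b h then inl (entry p) else inr (entry q))),
                 keep h)
      | Some (inl a) => let d := delta a h in (omap (Some \o inl) d.1, d.2)
      | Some (inr a) => let d := delta a h in (omap (Some \o inr) d.1, d.2)
      end
  | While b p => fun a h =>
      match a with
      | None => (if b h then Some (Some (entry p)) else None, keep h)
      | Some a => let d := delta a h in (Some d.1, d.2)
      end
  end.

Definition perform (s : tstate) (a : K -> sym * move) : tstate :=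
  (put s (fun k => (a k).1), fun k => shift (a k).2 1 (s.2 k)).

Inductive reach (p : tprog) :
    option (pstate p) -> tstate -> nat -> option (pstate p) -> tstate -> Prop :=
| reach_refl a s : reach a s 0 a s
| reach_step a s t b s' :
    (forall k, ((delta a (heads s)).2 k).2 = MoveLeft -> 0 < s.2 k) ->
    reach (delta a (heads s)).1 (perform s (delta a (heads s)).2) t b s' ->
    reach (Some a) s t.+1 b s'.

Lemma reach_trans p (a b c : option (pstate p)) s1 t1 s2 t2 s3 :
  reach a s1 t1 b s2 -> reach b s2 t2 c s3 -> reach a s1 (t1 + t2) c s3.
Proof.
by elim=> // {a b s1 t1 s2} a s1 t b s2 Hs _ IH /IH; apply: reach_step.
Qed.

(** Here [g] places the states of a subprogram among those of the whole program, and [f None] is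
    where control goes when the subprogram is left. *)
Lemma reach_embed p q (g : pstate p -> pstate q) (f : option (pstate p) -> option (pstate q))
    a s t b s' :
  (forall c, f (Some c) = Some (g c)) ->
  (forall c h, delta (g c) h = (f (delta c h).1, (delta c h).2)) ->
  reach a s t b s' -> reach (f a) s t (f b) s'.
Proof.
move=> Hf Hd; elim=> [|{a s t b s'} a s t b s' Hs _ IH]; first by move=> *; apply: reach_refl.
by rewrite Hf; apply: reach_step; rewrite Hd.
Qed.

Lemma put_heads s : put s (heads s) = s.1.
Proof.
apply: functional_extensionality => k; apply: functional_extensionality => i.
by rewrite /put /heads; case: eqP => // ->.
Qed.

Lemma perform_keep s : perform s (keep (heads s)) = s.
Proof. by rewrite /perform put_heads /=; case: s. Qed.

Lemma exec_reach p s t s' : exec p s t s' ->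
  exists2 t', t' <= t & reach (Some (entry p)) s t' None s'.
Proof.
elim=> {p s t s'}.
- move=> mv s t Hs Ht; exists 1 => //.
  apply: reach_step => //=; rewrite /perform /= put_heads; exact: reach_refl.
- move=> w s t Ht; exists 1 => //; apply: reach_step => //=.
  rewrite /perform /= (_ : (fun k => s.2 k) = s.2) //; exact: reach_refl.
- move=> p q s1 t1 s2 t2 s3 t _ [u1 Hu1 R1] _ [u2 Hu2 R2] Ht.
  exists (u1 + u2); first lia.
  (* The exit of the first program is the entry of the second. *)
  pose f (o : option (pstate p)) : option (pstate (TSeq p q)) :=
    Some (if o is Some b then inl b else inr (entry q)).
  apply: (@reach_trans (TSeq p q) _ (f None) _ _ _ s2).
    exact: (@reach_embed p (TSeq p q) inl f (Some (entry p)) _ _ None _ _ _ R1).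
  by apply: (@reach_embed q (TSeq p q) inr (omap inr) (Some (entry q)) _ _ None _ _ _ R2).
- move=> b p q s t1 s' t _ [u Hu R] Ht; exists u.+1; first lia.
  apply: (@reach_step (TIf b p q)) => //=; rewrite perform_keep.
  case: (b _) R => R.
    exact: (@reach_embed p (TIf b p q) (Some \o inl) (omap (Some \o inl)) (Some
        (entry p)) _ _ None _ _ _ R).
  exact: (@reach_embed q (TIf b p q) (Some \o inr) (omap (Some \o inr)) (Some
      (entry q)) _ _ None _ _ _ R).
- move=> b p s t Hb Ht; exists 1 => //.
  apply: (@reach_step (While b p)) => //=; rewrite perform_keep (negbTE Hb); exact: reach_refl.
move=> b p s1 t1 s2 t2 s3 t Hb _ [u1 Hu1 R1] _ [u2 Hu2 R2] Ht.
exists (u1 + u2).+1; first lia.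
apply: (@reach_step (While b p)) => //=; rewrite perform_keep Hb.
apply: (@reach_trans (While b p) _ (Some None) _ _ _ s2) => //.
exact: (@reach_embed p (While b p) Some Some (Some (entry p)) _ _ None _ _ _ R1).
Qed.

End TapePrograms.

Lemma answers_within_mono (M : turing_machine) w t u b :
  answers_within M w t b -> t <= u -> answers_within M w u b.
Proof.
rewrite /answers_within => H /subnK<-; rewrite iterD.
elim: (u - t) => //= m; case: (iter m _ _) => q ts /= ->.
by case: b {H} => /=; rewrite eqxx ?orbT.
Qed.

(** * Simulation of tape programs by multi-tape Turing machines *)

Section Machine.
Variables (K : finType) (p : tprog (option K)) (out : option K).

(** The input has to be on tape 0, which is named [None]. *)
Definition tape_index (k : option K) : 'I_#|K|.+1 :=
  if k is Some k then lift ord0 (enum_rank k) else ord0.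

Definition tape_name (i : 'I_#|K|.+1) : option K := omap enum_val (unlift ord0 i).

Lemma tape_indexK : cancel tape_index tape_name.
Proof.
case=> [k|]; rewrite /tape_index /tape_name; first by rewrite liftK /= enum_rankK.
by rewrite unlift_none.
Qed.

(** [inl None] means that the program has been left; [inr true] and [inr false] are the halting
    states. *)
Definition mstate : finType := (option (pstate p) + bool)%type.

Definition mtrans (q : mstate) (hs : {ffun 'I_#|K|.+1 -> sym}) :
    mstate * {ffun 'I_#|K|.+1 -> sym * move} :=
  let h k := hs (tape_index k) in
  match q with
  | inl (Some a) =>
      let d := delta a h in (inl d.1, [ffun i => d.2 (tape_name i)])
  | inl None => (inr (data (h out)), [ffun i => keep hs i])
  | inr b => (inr b, [ffun i => keep hs i])
  end.

Lemma sym_uniq : uniq [:: blank; bit_sym false; bit_sym true].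
Proof. by []. Qed.

Lemma inr_neq : (inr true : mstate) != inr false.
Proof. by []. Qed.

Definition machine : turing_machine :=
  @TuringMachine #|K| sym blank bit_sym sym_uniq mstate
    (inl (Some (entry p))) (inr true) (inr false) inr_neq mtrans.

(** Only the first [i] entries of the left list are constrained: a head never gets left of cell
    0. *)
Definition represents (t : tape machine) (f : nat -> sym) (i : nat) : Prop :=
  [/\ tape_head t = f i,
      forall k, nth blank (tape_right t) k = f (i + k).+1 &
      forall k, k < i -> nth blank (tape_left t) k = f (i - k.+1)].

Lemma represents_update t f i b m : represents t f i -> (m = MoveLeft -> 0 < i) ->
  represents (tape_update t (b, m)) (fun j => if j == i then b else f j) (shift m 1 i).
Proof.
case: t => l h r [/= Hh Hr Hl] Hm.
case: m Hm => /= Hm; first have Hi := Hm erefl.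
all: split=> /=.
- by rewrite -nth0 Hl //; case: eqP => //; lia.
- case=> [|k] /=; first by case: eqP => //; lia.
  by rewrite Hr; case: eqP => [|_]; [lia | congr f; lia].
- move=> k Hk; rewrite nth_behead Hl; last lia.
  by case: eqP => [|_]; [lia | congr f; lia].
- by rewrite -nth0 Hr; case: eqP => [|_]; [lia | congr f; lia].
- by move=> k; rewrite nth_behead Hr; case: eqP => [|_]; [lia | congr f; lia].
- case=> [|k] Hk /=; first by case: eqP => //; lia.
  by rewrite Hl; [case: eqP => [|_]; [lia | congr f; lia] | lia].
- by rewrite eqxx.
- by move=> k; rewrite Hr; case: eqP => //; lia.
by move=> k Hk; rewrite Hl //; case: eqP => //; lia.
Qed.

Definition simulates (c : config machine) (s : tstate (option K)) : Prop :=
  forall k, represents (c.2 (tape_index k)) (s.1 k) (s.2 k).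

Definition init_state (w : seq bool) : tstate (option K) :=
  (fun k i => if k is None then nth blank (map bit_sym w) i else blank, fun=> 0).

Lemma simulates_init w : simulates (init_config machine w) (init_state w).
Proof.
move=> k; rewrite /= ffunE; case: k => [k|]; split=> //= j.
  by rewrite nth_nil.
by rewrite nth_behead add0n.
Qed.

Lemma simulates_reach (a b : option (pstate p)) s t s' c :
  reach a s t b s' -> c.1 = inl a -> simulates c s ->
  exists2 c', iter t (@step machine) c = c' & c'.1 = inl b /\ simulates c' s'.
Proof.
move=> R; elim: R c => {a s t b s'} [a s|a s t b s' Hs _ IH] c Hc Sc.
  by exists c.
rewrite iterSr; apply: IH.
  case: c Hc Sc => q ts /= -> Sc; congr (inl (delta _ _).1).
  by apply: functional_extensionality => k; rewrite ffunE; case: (Sc k).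
case: c Hc Sc => q ts /= -> Sc k /=; rewrite ffunE /= ffunE tape_indexK.
have -> : (fun k => [ffun i => tape_head (ts i)] (tape_index k)) = heads s.
  by apply: functional_extensionality => j; rewrite ffunE; case: (Sc j).
have := represents_update ((delta a (heads s)).2 k).1 (Sc k) (Hs k).
by rewrite -surjective_pairing.
Qed.

(** The additional step reads the answer under the head of tape [out] and enters a halting state. *)
Lemma machine_answers w t s : exec p (init_state w) t s ->
  answers_within machine w t.+1 (data (heads s out)).
Proof.
move=> /exec_reach[t' Ht' R].
have [c Ec [Hc Sc]] := simulates_reach R (c := init_config machine w) erefl (simulates_init w).
apply: (@answers_within_mono _ _ t'.+1) => //; rewrite /answers_within iterS Ec.
case: c Hc Sc {Ec} => q ts /= -> Sc; have [Hout _ _] := Sc out.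
by rewrite /= ffunE Hout -/(heads s out); case: (data _).
Qed.

End Machine.

(** * Loop programs *)

Definition upd (T : eqType) (U : Type) (f : T -> U) (a : T) (v : U) : T -> U :=
  fun b => if b == a then v else f b.

Section Loop.
Variables X Y : finType.

Inductive cmd :=
| Skip
| Set_ of Y & X & bool
| IfGet of Y & X & cmd & cmd
| IfAdj of X & X & cmd & cmd
| Seq of cmd & cmd
| For of X & cmd.

Definition env := X -> nat.
Definition arrays := Y -> nat -> bool.

Definition store (ar : arrays) (y : Y) (i : nat) (b : bool) : arrays :=
  upd ar y (upd (ar y) i b).

Fixpoint eval (n : nat) (A : rel nat) (c : cmd) (e : env) (ar : arrays) : arrays :=
  match c with
  | Skip => ar
  | Set_ y x b => store ar y (e x) b
  | IfGet y x c1 c2 =>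
      if ar y (e x) then eval n A c1 e ar else eval n A c2 e ar
  | IfAdj x x' c1 c2 =>
      if A (e x) (e x') then eval n A c1 e ar else eval n A c2 e ar
  | Seq c1 c2 => eval n A c2 e (eval n A c1 e ar)
  | For x c => foldl (fun ar i => eval n A c (upd e x i) ar) ar (iota 0 n)
  end.

(* B holds for the variables bound by an enclosing loop: a loop starts and ends
   with the head of its variable at 0, so variables must not be reused inside. *)
Fixpoint well_scoped (B : pred X) (c : cmd) : bool :=
  match c with
  | Skip => true
  | Set_ _ _ _ => true
  | IfGet _ _ c1 c2 => well_scoped B c1 && well_scoped B c2
  | IfAdj x x' c1 c2 =>
      [&& B x, B x', well_scoped B c1 & well_scoped B c2]
  | Seq c1 c2 => well_scoped B c1 && well_scoped B c2
  | For x c => ~~ B x && well_scoped (upd B x true) c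
  end.

(* Besides the input tape tM there are: a scratch counter tS, a ruler tR used to
   count off one row of the matrix, a one-cell register tQ for the result of a
   query, for every variable x a ruler tX x whose head position is the value of
   x, and for every array y a tape tY y.  Rulers have marks on cells 0 and n. *)
Definition reg : finType := (option bool + (X + Y))%type.
Definition tM : option reg := None.
Definition tS : option reg := Some (inl None).
Definition tR : option reg := Some (inl (Some false)).
Definition tQ : option reg := Some (inl (Some true)).
Definition tX (x : X) : option reg := Some (inr (inl x)).
Definition tY (y : Y) : option reg := Some (inr (inr y)).

(** * Compilation of loop programs *)

Definition go (L R : seq (option reg)) (k : option reg) : move :=
  if k \in L then MoveLeft else if k \in R then MoveRight else Stay.

(** Transfers the head position of [k] to the tapes in [R]. From array heads resting on cell 0 this
    reaches the cell indexed by a variable. *)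
Definition rewind (k : option reg) (R : seq (option reg)) : tprog (option reg) :=
  While (fun h => ~~ leftmost (h k)) (Move (go [:: k] R)).

(** Reverses a rewinding: the scratch counter has kept the old position of [k]. *)
Definition unslide (k : option reg) (L : seq (option reg)) : tprog (option reg) :=
  While (fun h => ~~ leftmost (h tS)) (Move (go (tS :: L) [:: k])).

Definition remember (k : option reg) : tprog (option reg) :=
  Write (fun h => upd h tQ (data (h k), false, false)).

Definition tget (y : Y) (x : X) : tprog (option reg) :=
  TSeq (rewind (tX x) [:: tS; tY y])
    (TSeq (remember (tY y)) (unslide (tX x) [:: tY y])).

Definition tset (y : Y) (x : X) (b : bool) : tprog (option reg) :=
  TSeq (rewind (tX x) [:: tS; tY y])
    (TSeq (Write (fun h => upd h (tY y) (b, false, false)))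
       (unslide (tX x) [:: tY y])).

Definition skip_row : tprog (option reg) :=
  TSeq (While (fun h => ~~ rightmost (h tR)) (Move (go [::] [:: tR; tM])))
       (rewind tR [::]).

Definition skip_rows (x : X) : tprog (option reg) :=
  While (fun h => ~~ leftmost (h (tX x)))
    (TSeq (Move (go [:: tX x] [:: tS])) skip_row).

(** The wanted entry lies [x] rows and then [x'] cells to the right of the start of the matrix,
    where the input head rests. *)
Definition tadj (x x' : X) : tprog (option reg) :=
  TSeq (skip_rows x) (TSeq (unslide (tX x) [::])
    (TSeq (rewind (tX x') [:: tS; tM]) (TSeq (unslide (tX x') [::])
       (TSeq (remember tM) (rewind tM [::]))))).

Fixpoint compile (c : cmd) : tprog (option reg) :=
  match c with
  | Skip => Move (fun=> Stay)
  | Set_ y x b => tset y x b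
  | IfGet y x c1 c2 =>
      TSeq (tget y x) (TIf (fun h => data (h tQ)) (compile c1) (compile c2))
  | IfAdj x x' c1 c2 =>
      TSeq (tadj x x') (TIf (fun h => data (h tQ)) (compile c1) (compile c2))
  | Seq c1 c2 => TSeq (compile c1) (compile c2)
  | For x c =>
      TSeq (While (fun h => ~~ rightmost (h (tX x)))
              (TSeq (compile c) (Move (go [::] [:: tX x]))))
           (rewind (tX x) [::])
  end.

Fixpoint cost (n : nat) (c : cmd) : nat :=
  match c with
  | Skip => 1
  | Set_ _ _ _ => 4 * n + 3
  | IfGet _ _ c1 c2 => 4 * n + 4 + cost n c1 + cost n c2
  | IfAdj _ _ c1 c2 => 6 * (n * n) + 10 * n + 7 + cost n c1 + cost n c2
  | Seq c1 c2 => cost n c1 + cost n c2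
  | For x c => n * (cost n c + 2) + 2 * n + 2
  end.

Definition contents (n : nat) (inp : nat -> sym) (ar : arrays) (q : bool)
    (k : option reg) (i : nat) : sym :=
  match k with
  | None => inp i
  | Some (inl (Some true)) => if i == 0 then (q, false, false) else blank
  | Some (inl _) | Some (inr (inl _)) => (false, i == 0, i == n)
  | Some (inr (inr y)) => (ar y i, false, false)
  end.

(** On the input tape, cell [n.+1] is the first one of the matrix: [n] unary ones and the separator
    precede it. *)
Definition rest (n : nat) (e : env) (k : option reg) : nat :=
  match k with
  | None => n.+1
  | Some (inr (inl x)) => e x
  | _ => 0
  end.

(** * Correctness and running time of compiled programs *)

Lemma rest_upd n e x i : rest n (upd e x i) = upd (rest n e) (tX x) i.
Proof.
by apply: functional_extensionality => -[[k|[x'|y]]|].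
Qed.

Ltac positions := let k := fresh "k" in
  apply: functional_extensionality => k; rewrite /shifts /go /upd ?inE;
  repeat (case: eqP => ?); try subst k; rewrite /=; try congruence; try lia.

(** The marked cell [b] is 0 on the rulers and [n.+1] on the input tape. *)
Lemma exec_rewind F P k R b t :
  (forall i, leftmost (F k i) = (i == b)) -> b <= P k -> 2 * (P k - b) < t ->
  exec (rewind k R) (F, P) t (F, shifts (go [:: k] R) (P k - b) P).
Proof.
move=> Hk Hb Ht; apply: (@exec_scan _ _ _ _ (F, P)) => //=.
- by move=> j Hj; rewrite /heads /= Hk /shifts /go inE eqxx /=; lia.
- by rewrite /heads /= Hk /shifts /go inE eqxx /=; lia.
by move=> k'; rewrite /go inE; case: eqP => [->|_]; [lia|case: ifP].
Qed.

Lemma exec_unslide F P k L t :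
  (forall i, leftmost (F tS i) = (i == 0)) -> {in L, forall k', P tS <= P k'} ->
  2 * P tS < t ->
  exec (unslide k L) (F, P) t (F, shifts (go (tS :: L) [:: k]) (P tS) P).
Proof.
move=> Hk HL Ht; apply: (@exec_scan _ _ _ _ (F, P)) => //=.
- by move=> j Hj; rewrite /heads /= Hk /shifts /go inE eqxx /=; lia.
- by rewrite /heads /= Hk /shifts /go inE eqxx /=; lia.
move=> k'; rewrite /go inE; case: eqP => [->|_] //=.
by case: ifP => [/HL|_] //; case: ifP.
Qed.

Section Correctness.
Variables (n : nat) (inp : nat -> sym) (A : rel nat).
Hypothesis inp_leftmost : forall i, leftmost (inp i) = (i == n.+1).
Hypothesis inp_data : forall i j, i < n -> j < n -> A i j = data (inp (n.+1 + (i * n + j))).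

Lemma contents_remember ar q P b :
  P tQ = 0 ->
  put (contents n inp ar q, P)
    (upd (heads (contents n inp ar q, P)) tQ (b, false, false)) = contents n inp ar b.
Proof.
move=> HQ; apply: functional_extensionality => k; apply: functional_extensionality => i.
rewrite /put /upd /heads /=; have [->|ne] := eqVneq k tQ; first by rewrite HQ /=; case: (i == 0).
have -> : contents n inp ar b k i = contents n inp ar q k i by case: k ne => [[[[]|]|[?|?]]|].
by case: eqP => [->|].
Qed.

Lemma contents_store ar q P y b :
  put (contents n inp ar q, P)
    (upd (heads (contents n inp ar q, P)) (tY y) (b, false, false)) =
  contents n inp (store ar y (P (tY y)) b) q.
Proof.
apply: functional_extensionality => k; apply: functional_extensionality => i.
rewrite /put /upd /heads /=; have [->|ne] := eqVneq k (tY y).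
  by rewrite /= /store /upd eqxx; case: ifP.
have -> : contents n inp (store ar y (P (tY y)) b) q k i = contents n inp ar q k i.
  case: k ne => [[k|[x'|y']]|] //= ne.
  by rewrite /store /upd; have [Ey|//] := eqVneq y' y; rewrite Ey eqxx in ne.
by case: eqP => [->|].
Qed.

Lemma exec_tget ar q e x y : e x <= n ->
  exec (tget y x) (contents n inp ar q, rest n e) (4 * n + 3)
    (contents n inp ar (ar y (e x)), rest n e).
Proof.
move=> Hx; set P := shifts (go [:: tX x] [:: tS; tY y]) (e x) (rest n e).
have PY : P (tY y) = e x by rewrite /P /shifts /go !inE eqxx orbT.
have PS : P tS = e x by rewrite /P /shifts /go !inE eqxx.
apply: (@exec_seq _ _ _ _ (2 * n + 1) (contents n inp ar q, P) (2 * n + 2)); last lia.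
  by have := @exec_rewind (contents n inp ar q) (rest n e) (tX x) [:: tS; tY y] 0 (2 * n + 1);
      rewrite /= subn0; apply => //; lia.
apply: (@exec_seq _ _ _ _ 1 (contents n inp ar (ar y (e x)), P) (2 * n + 1)); last lia.
  have := @exec_write _ (fun h => upd h tQ (data (h (tY y)), false, false))
      (contents n inp ar q, P) 1 isT.
  by rewrite contents_remember //= /heads /= PY.
have <- : shifts (go [:: tS; tY y] [:: tX x]) (P tS) P = rest n e.
  by rewrite PS /P; positions.
by apply: exec_unslide => //; [move=> k; rewrite inE => /eqP->; lia | lia].
Qed.

Lemma exec_tset ar q e x y b : e x <= n ->
  exec (tset y x b) (contents n inp ar q, rest n e) (4 * n + 3)
    (contents n inp (store ar y (e x) b) q, rest n e).
Proof.
move=> Hx; set P := shifts (go [:: tX x] [:: tS; tY y]) (e x) (rest n e).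
have PY : P (tY y) = e x by rewrite /P /shifts /go !inE eqxx orbT.
have PS : P tS = e x by rewrite /P /shifts /go !inE eqxx.
apply: (@exec_seq _ _ _ _ (2 * n + 1) (contents n inp ar q, P) (2 * n + 2)); last lia.
  by have := @exec_rewind (contents n inp ar q) (rest n e) (tX x) [:: tS; tY y] 0 (2 * n + 1);
      rewrite /= subn0; apply => //; lia.
apply: (@exec_seq _ _ _ _ 1 (contents n inp (store ar y (e x) b) q, P) (2 * n + 1)); last lia.
  have := @exec_write _ (fun h => upd h (tY y) (b, false, false)) (contents n inp ar q, P) 1 isT.
  by rewrite contents_store PY.
have <- : shifts (go [:: tS; tY y] [:: tX x]) (P tS) P = rest n e.
  by rewrite PS /P; positions.
by apply: exec_unslide => //; [move=> k; rewrite inE => /eqP->; lia | lia].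
Qed.

Lemma exec_skip_row ar q P : P tR = 0 ->
  exec skip_row (contents n inp ar q, P) (4 * n + 2)
    (contents n inp ar q, upd P tM (P tM + n)).
Proof.
move=> HR; set P' := shifts (go [::] [:: tR; tM]) n P.
have PR : P' tR = n by rewrite /P' /shifts /go !inE eqxx /= HR.
apply: (@exec_seq _ _ _ _ (2 * n + 1) (contents n inp ar q, P') (2 * n + 1)); last lia.
  apply: (@exec_scan _ _ _ _ (_, P)) => //=; last lia.
  - by move=> j Hj; rewrite /heads /shifts /go !inE eqxx /= HR /rightmost /=; lia.
  - by rewrite /heads /shifts /go !inE eqxx /= HR /rightmost /=; lia.
  by move=> k; rewrite /go /=; case: ifP.
have <- : shifts (go [:: tR] [::]) (P' tR - 0) P' = upd P tM (P tM + n).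
  by rewrite subn0 PR /P'; positions.
by apply: exec_rewind => //; lia.
Qed.

Lemma exec_skip_rows ar q P x i : P tR = 0 -> P (tX x) = i ->
  exec (skip_rows x) (contents n inp ar q, P) (i * (4 * n + 4) + 1)
    (contents n inp ar q,
     upd (upd (upd P (tX x) 0) tS (P tS + i)) tM (P tM + i * n)).
Proof.
elim: i P => [|i IH] P HR Hx.
  have -> : upd (upd (upd P (tX x) 0) tS (P tS + 0)) tM (P tM + 0 * n) = P by positions.
  by apply: exec_while_end => //; rewrite negbK /heads /= Hx.
set P1 := shifts (go [:: tX x] [:: tS]) 1 P.
set P2 := upd P1 tM (P1 tM + n).
have P1R : P1 tR = 0 by rewrite -HR /P1 /shifts /go !inE.
apply: (@exec_while _ _ _ _ (4 * n + 3) (contents n inp ar q, P2) (i * (4 * n + 4) + 1));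
    last lia.
- by rewrite /heads /= Hx.
- apply: (@exec_seq _ _ _ _ 1 (contents n inp ar q, P1) (4 * n + 2)); last lia.
    apply: (@exec_move _ _ (contents n inp ar q, P)) => //= k.
    by rewrite /go !inE; case: eqP => [->|_]; [lia | case: ifP].
  exact: exec_skip_row.
have := IH P2; rewrite /P2 {1 2}/upd /= {2}/P1 /shifts /go !inE eqxx /= Hx.
move=> /(_ P1R (subn1 _)).
congr exec; congr pair.
by rewrite /P1; positions.
Qed.

Lemma exec_tadj ar q e x x' : e x < n -> e x' < n ->
  exec (tadj x x') (contents n inp ar q, rest n e) (6 * (n * n) + 10 * n + 6)
    (contents n inp ar (A (e x) (e x')), rest n e).
Proof.
move=> Hx Hx'; set F := contents n inp ar q.
pose P1 := upd (upd (upd (rest n e) (tX x) 0) tS (e x)) tM (n.+1 + e x * n).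
pose P2 := upd (rest n e) tM (n.+1 + e x * n).
pose P3 := upd (upd (upd (rest n e) (tX x') 0) tS (e x')) tM (n.+1 + (e x * n + e x')).
pose P4 := upd (rest n e) tM (n.+1 + (e x * n + e x')).
have Hm : e x * n + e x' <= n * n by nia.
have F0 k : k != tM -> k != tQ -> (forall y, k != tY y) -> forall i, leftmost (F k i) = (i == 0).
  by case: k => [[[[]|]|[?|y]]|] // _ _ /(_ y); rewrite eqxx.
apply: (@exec_seq _ _ _ _ (n * (4 * n + 4) + 1) (F, P1) (2 * (n * n) + 6 * n + 5)); last lia.
  apply: (@exec_le _ _ _ (e x * (4 * n + 4) + 1)); last nia.
  exact: (@exec_skip_rows ar q (rest n e) x (e x)).
apply: (@exec_seq _ _ _ _ (2 * n + 1) (F, P2) (2 * (n * n) + 4 * n + 4)); last lia.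
  have <- : shifts (go [:: tS] [:: tX x]) (P1 tS) P1 = P2.
    have -> : P1 tS = e x by [].
    by rewrite /P1 /P2; positions.
  by apply: exec_unslide => //; rewrite (_ : P1 tS = e x) //; lia.
apply: (@exec_seq _ _ _ _ (2 * n + 1) (F, P3) (2 * (n * n) + 2 * n + 3)); last lia.
  have <- : shifts (go [:: tX x'] [:: tS; tM]) (P2 (tX x') - 0) P2 = P3.
    have -> : P2 (tX x') = e x' by [].
    by rewrite /P2 /P3; positions.
  by apply: exec_rewind => //; rewrite (_ : P2 (tX x') = e x') //; lia.
apply: (@exec_seq _ _ _ _ (2 * n + 1) (F, P4) (2 * (n * n) + 2)); last lia.
  have <- : shifts (go [:: tS] [:: tX x']) (P3 tS) P3 = P4.
    have -> : P3 tS = e x' by [].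
    by rewrite /P3 /P4; positions.
  by apply: exec_unslide => //; rewrite (_ : P3 tS = e x') //; lia.
apply: (@exec_seq _ _ _ _ 1 (contents n inp ar (A (e x) (e x')), P4) (2 * (n * n) + 1)); last lia.
  have := @exec_write _ (fun h => upd h tQ (data (h tM), false, false)) (F, P4) 1 isT.
  by rewrite contents_remember //= inp_data.
have <- : shifts (go [:: tM] [::]) (P4 tM - n.+1) P4 = rest n e.
  have -> : P4 tM = n.+1 + (e x * n + e x') by [].
  by rewrite /P4; positions.
by apply: exec_rewind => //; rewrite (_ : P4 tM = n.+1 + (e x * n + e x')) //; lia.
Qed.

(** Queries overwrite the register [tQ], whose final content [q'] is therefore left open. *)
Lemma exec_compile B c e ar q : well_scoped B c ->
  (forall x, B x -> e x < n) -> (forall x, ~~ B x -> e x = 0) ->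
  exists q', exec (compile c) (contents n inp ar q, rest n e) (cost n c)
    (contents n inp (eval n A c e ar) q', rest n e).
Proof.
elim: c B e ar q => [|y x b|y x c1 IH1 c2 IH2|x x' c1 IH1 c2 IH2|c1 IH1 c2 IH2|x c IH] B e ar q /= Hc He He0.
- exists q.
  have := @exec_move _ (fun=> Stay) (contents n inp ar q, rest n e) 1 (fun _ => ltac:(done)) isT.
  by congr exec; congr pair; apply: functional_extensionality.
- by exists q; apply: exec_tset; case: (boolP (B x)) => [/He|/He0]; lia.
- have [c1_wf c2_wf] := andP Hc.
  have [q1 H1] := IH1 B e ar (ar y (e x)) c1_wf He He0.
  have [q2 H2] := IH2 B e ar (ar y (e x)) c2_wf He He0.
  exists (if ar y (e x) then q1 else q2).
  apply: (@exec_seq _ _ _ _ (4 * n + 3) (contents n inp ar (ar y (e x)), rest n e)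
      (cost n c1 + cost n c2 + 1)); last lia.
    by apply: exec_tget; case: (boolP (B x)) => [/He|/He0]; lia.
  apply: (@exec_if _ _ _ _ _ (cost n c1 + cost n c2)); last lia.
  rewrite {1}/heads /= {1}/data /=; case: (ar y (e x)) H1 H2 => H1 H2.
    by apply: exec_le H1 _; lia.
  by apply: exec_le H2 _; lia.
- have [Bx Bx' c1_wf c2_wf] := and4P Hc.
  have [q1 H1] := IH1 B e ar (A (e x) (e x')) c1_wf He He0.
  have [q2 H2] := IH2 B e ar (A (e x) (e x')) c2_wf He He0.
  exists (if A (e x) (e x') then q1 else q2).
  apply: (@exec_seq _ _ _ _ (6 * (n * n) + 10 * n + 6) (contents n inp ar (A (e x)
      (e x')), rest n e) (cost n c1 + cost n c2 + 1)); last lia.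
    by apply: exec_tadj; apply: He.
  apply: (@exec_if _ _ _ _ _ (cost n c1 + cost n c2)); last lia.
  rewrite {1}/heads /= {1}/data /=; case: (A (e x) (e x')) H1 H2 => H1 H2.
    by apply: exec_le H1 _; lia.
  by apply: exec_le H2 _; lia.
- have [c1_wf c2_wf] := andP Hc.
  have [q1 H1] := IH1 B e ar q c1_wf He He0.
  have [q2 H2] := IH2 B e (eval n A c1 e ar) q1 c2_wf He He0.
  by exists q2; apply: exec_seq H1 H2 _.
have [Bx c_wf] := andP Hc.
(* With [m] rounds left, each round costs the body, a move and a test. *)
have loop m i ar' q' : i + m = n -> exists q'',
    exec (While (fun h => ~~ rightmost (h (tX x))) (TSeq (compile c) (Move (go [::] [:: tX x]))))
      (contents n inp ar' q', rest n (upd e x i)) (m * (cost n c + 2) + 1)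
      (contents n inp (foldl (fun ar i => eval n A c (upd e x i) ar) ar' (iota i m)) q'',
       rest n (upd e x n)).
  elim: m i ar' q' => [|m IHm] i ar' q' Hi.
    exists q'; rewrite addn0 in Hi; subst i; apply: exec_while_end => //.
    by rewrite negbK /heads /= /upd eqxx /rightmost /= eqxx.
  have [q1 H1] : exists q1, exec (compile c) (contents n inp ar' q', rest n (upd e x i))
      (cost n c)
      (contents n inp (eval n A c (upd e x i) ar') q1, rest n (upd e x i)).
    apply: IH c_wf _ _ => z; rewrite /upd; case: eqP => //; first lia.
    - by move=> _; apply: He.
    - by move=> _; apply: He0.
  have [q2 H2] := IHm i.+1 (eval n A c (upd e x i) ar') q1 ltac:(lia).
  exists q2; apply: (exec_while (t1 := cost n c + 1)) H2 _; last lia.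
    by rewrite /heads /= /upd eqxx /rightmost /=; lia.
  apply: (exec_seq (t2 := 1)) H1 _ _; last lia.
  have -> : rest n (upd e x i.+1) = shifts (go [::] [:: tX x]) 1 (rest n (upd e x i)).
    by rewrite !rest_upd; positions.
  apply: (@exec_move _ _ (contents n inp _ _, _)) => //= k.
  by rewrite /go in_nil; case: ifP.
have [q1 H1] := loop n 0 ar q (add0n n).
(* The variable is not bound outside the loop, so its head is already on cell 0. *)
have E0 : upd e x 0 = e.
  by apply: functional_extensionality => z; rewrite /upd; case: eqP => // ->; rewrite He0.
rewrite E0 in H1; exists q1; apply: (exec_seq (t2 := 2 * n + 1)) H1 _ _; last lia.
have <- : shifts (go [:: tX x] [::]) (rest n (upd e x n) (tX x) - 0) (rest n
    (upd e x n)) = rest n e.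
  by rewrite rest_upd {1}/upd eqxx -[in RHS]E0 rest_upd; positions.
by apply: exec_rewind => //; rewrite /= /upd eqxx; lia.
Qed.

End Correctness.
End Loop.

(** * Initialisation of the tapes *)

Section Boot.
Variables X Y : finType.

Definition ruler (k : option (reg X Y)) : bool :=
  match k with
  | Some (inl (Some true)) => false
  | Some (inl _) | Some (inr (inl _)) => true
  | _ => false
  end.

(** The rulers are measured against the unary prefix of the input. The second marking keeps the left
    mark, because cells 0 and [n] coincide for [n = 0]. Finally the start of the matrix is marked
    and the rulers are rewound. *)
Definition boot : tprog (option (reg X Y)) :=
  TSeq (Write (fun h k => if ruler k then (false, true, false) else h k))
  (TSeq (While (fun h => data (h (tM X Y)))
          (Move (fun k => if ruler k || (k == tM X Y) then MoveRight else Stay)))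
  (TSeq (Write (fun h k => if ruler k then (false, leftmost (h k), true) else h k))
  (TSeq (Move (fun k => if k == tM X Y then MoveRight else Stay))
  (TSeq (Write (fun h => upd h (tM X Y) (data (h (tM X Y)), true, rightmost (h (tM X Y)))))
        (While (fun h => ~~ leftmost (h (tS X Y)))
          (Move (fun k => if ruler k then MoveLeft else Stay))))))).

Definition boot_input (n : nat) (w : seq bool) (i : nat) : sym :=
  let a := nth blank (map bit_sym w) i in (data a, i == n.+1, rightmost a).

Lemma exec_boot n mat (w := nseq n true ++ false :: mat) :
  exec boot (init_state (reg X Y) w) (4 * n + 6)
    (contents n (boot_input n w) (fun _ _ => false) false, rest n (fun=> 0)).
Proof.
pose F0 := (init_state (reg X Y) w).1.
pose F1 k i : sym := if ruler k then (false, i == 0, false) else F0 k i.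
pose F2 k i : sym := if ruler k then (false, i == 0, i == n) else F0 k i.
pose P1 (k : option (reg X Y)) := if ruler k || (k == tM X Y) then n else 0.
pose P2 (k : option (reg X Y)) := if ruler k then n else rest n (fun=> 0) k.
have Fn : F0 (tM X Y) n = bit_sym false.
  by rewrite /F0 /= map_cat nth_cat size_map size_nseq ltnn subnn.
apply: (@exec_seq _ _ _ _ 1 (F1, fun=> 0) (4 * n + 5)); last lia.
  have -> : F1 = put (init_state (reg X Y) w) (fun k => if ruler k then
      (false, true, false) else heads (init_state (reg X Y) w) k).
    apply: functional_extensionality => k; apply: functional_extensionality => i.
    by rewrite /F1 /put /heads /=; case: k => [[[[]|]|[?|?]]|] /=; case: eqP => // ->.
  exact: (@exec_write _ _ (init_state (reg X Y) w)).
apply: (@exec_seq _ _ _ _ (2 * n + 1) (F1, P1) (2 * n + 4)); last lia.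
  have -> : P1 = shifts (fun k => if ruler k || (k == tM X Y) then MoveRight else Stay) n
      (fun=> 0).
    by apply: functional_extensionality => k; rewrite /P1 /shifts; case: ifP.
  apply: (@exec_scan _ _ _ _ (F1, fun=> 0)) => /=; last lia.
  - move=> j Hj; rewrite /heads /F1 /= /F0 /shifts /= map_cat nth_cat size_map size_nseq add0n Hj.
    by rewrite map_nseq nth_nseq Hj.
  - by rewrite /heads /F1 /shifts /= add0n Fn.
  by move=> k; case: ifP.
apply: (@exec_seq _ _ _ _ 1 (F2, P1) (2 * n + 3)); last lia.
  have -> : F2 = put (F1, P1) (fun k => if ruler k then (false, leftmost (heads
      (F1, P1) k), true) else heads (F1, P1) k).
    apply: functional_extensionality => k; apply: functional_extensionality => i.
    rewrite /F2 /put /heads /= /F1 /P1; case: (ruler k) => /=.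
      by have [->|_] := eqVneq i n.
    by case: eqP => [->|].
  exact: (@exec_write _ _ (F1, P1)).
apply: (@exec_seq _ _ _ _ 1 (F2, P2) (2 * n + 2)); last lia.
  have -> : P2 = shifts (fun k => if k == tM X Y then MoveRight else Stay) 1 P1.
    apply: functional_extensionality => k; rewrite /P2 /P1 /shifts.
    by case: k => [[[[]|]|[?|?]]|] //=; rewrite addn1.
  by apply: (@exec_move _ _ (F2, P1)) => // k; case: ifP.
have -> : rest n (fun=> 0) = shifts (fun k => if ruler k then MoveLeft else Stay) n P2.
  apply: functional_extensionality => k; rewrite /P2 /shifts.
  by case: k => [[[[]|]|[?|?]]|] //=; lia.
set F3 := contents _ _ _ _.
apply: (@exec_seq _ _ _ _ 1 (F3, P2) (2 * n + 1)); last lia.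
  have -> : F3 = put (F2, P2) (upd (heads (F2, P2)) (tM X Y) (data (heads (F2, P2)
      (tM X Y)), true, rightmost (heads (F2, P2) (tM X Y)))).
    apply: functional_extensionality => k; apply: functional_extensionality => i.
    rewrite /F3 /put /upd /heads /F2 /P2 /=.
    case: k => [[[[]|]|[?|?]]|] /=.
    1: by case: (i == 0).
    1-3: by have [->|_] := eqVneq i n; rewrite ?eqxx.
    1: by case: (i == 0).
    rewrite /boot_input /F0 /=; have [->|_] := eqVneq i n.+1; first by [].
    have [Hi|Hi] := ltnP i (size w); last by rewrite nth_default // size_map.
    by rewrite (nth_map false).
  exact: (@exec_write _ _ (F2, P2)).
apply: (@exec_scan _ _ _ _ (F3, P2)) => /=; last lia.
- move=> j Hj; rewrite /heads /F3 /shifts /P2 /= /leftmost /=. by case: eqP => //; lia.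
- by rewrite /heads /F3 /shifts /= subnn.
by move=> k; rewrite /P2; case: ifP.
Qed.

End Boot.

(** * Polynomial time bounds *)

Definition poly_bounded (f : nat -> nat) : Prop :=
  exists a d, forall n, f n <= a * n.+1 ^ d.

Lemma poly_boundedC a : poly_bounded (fun=> a).
Proof. by exists a, 0 => n; rewrite muln1. Qed.

Lemma poly_bounded_id : poly_bounded id.
Proof. by exists 1, 1 => n; rewrite mul1n expn1. Qed.

Lemma poly_boundedD f g :
  poly_bounded f -> poly_bounded g -> poly_bounded (fun n => f n + g n).
Proof.
move=> [a [d Hf]] [b [k Hg]]; exists (a + b), (d + k) => n.
(* The base [n.+1] is positive, so either power is at most their product. *)
rewrite mulnDl expnD; apply: leq_add.
  by apply: leq_trans (Hf n) _; rewrite leq_mul2l leq_pmulr ?orbT // expn_gt0.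
by apply: leq_trans (Hg n) _; rewrite leq_mul2l leq_pmull ?orbT // expn_gt0.
Qed.

Lemma poly_boundedM f g :
  poly_bounded f -> poly_bounded g -> poly_bounded (fun n => f n * g n).
Proof.
move=> [a [d Hf]] [b [k Hg]]; exists (a * b), (d + k) => n.
by rewrite expnD mulnACA leq_mul.
Qed.

Lemma poly_bounded_cost (X Y : finType) (c : cmd X Y) : poly_bounded (fun n => cost n c).
Proof.
have lin a b : poly_bounded (fun n => a * n + b).
  by apply: poly_boundedD (poly_boundedC _);
      apply: poly_boundedM (poly_boundedC _) poly_bounded_id.
elim: c => [|y x b|y x c1 IH1 c2 IH2|x x' c1 IH1 c2 IH2|c1 IH1 c2 IH2|x c IH] /=.
- exact: poly_boundedC.
- exact: lin.
- by apply: poly_boundedD IH2; apply: poly_boundedD IH1; apply: lin.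
- apply: poly_boundedD IH2; apply: poly_boundedD IH1; apply: poly_boundedD (poly_boundedC _).
  apply: poly_boundedD (poly_boundedM (poly_boundedC _) poly_bounded_id).
  apply: poly_boundedM (poly_boundedC _) _; exact: poly_boundedM poly_bounded_id poly_bounded_id.
- exact: poly_boundedD.
apply: poly_boundedD (poly_boundedC _);
    apply: poly_boundedD (poly_boundedM (poly_boundedC _) poly_bounded_id).
by apply: poly_boundedM poly_bounded_id _; apply: poly_boundedD IH (poly_boundedC _).
Qed.

(** The array heads rest on cell 0, so the answer is read there. *)
Lemma loop_machine (X Y : finType) (c : cmd X Y) (y : Y) : well_scoped pred0 c ->
  exists (M : turing_machine) (a d : nat), forall n mat,
    answers_within M (nseq n true ++ false :: mat) (a * n.+1 ^ d)
      (eval n (fun i j => nth false mat (i * n + j)) c (fun=> 0) (fun _ _ => false) y 0).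
Proof.
move=> c_wf.
(* The summands pay for initialisation, the program itself, and the step into the halting state. *)
have [a [d Had]] : poly_bounded (fun n => 4 * n + 6 + cost n c + 1).
  apply: poly_boundedD (poly_boundedC _); apply: poly_boundedD (poly_bounded_cost c).
  apply: poly_boundedD (poly_boundedC _); exact: poly_boundedM (poly_boundedC _) poly_bounded_id.
exists (machine (TSeq (boot X Y) (compile c)) (tY X y)), a, d => n mat.
set w := _ ++ _; set A := fun i j => _.
have inp_data i j : i < n -> j < n -> A i j = data (boot_input n w (n.+1 + (i * n + j))).
  move=> Hi Hj; rewrite /boot_input /= map_cat nth_cat size_map size_nseq.
  rewrite ltnNge addSn -addnS leq_addr /= addKn /=.
  have [Hm|Hm] := ltnP (i * n + j) (size mat); first by rewrite (nth_map false).
  by rewrite /A !nth_default ?size_map.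
have [q H] := @exec_compile X Y n (boot_input n w) A (fun _ => erefl) inp_data pred0 c
  (fun=> 0) (fun _ _ => false) false c_wf (fun _ H => False_ind _ (notF H)) (fun _ _ => erefl).
have E := exec_seq (exec_boot X Y n mat) H (leqnn _).
have := Had n; case: (a * _) => [|t]; first by lia.
rewrite addn1 ltnS => Ht; exact: machine_answers (exec_le E Ht).
Qed.

(** * Compound tests, assignments and loop invariants *)

Section Macros.
Variables X Y : finType.

Inductive test := Get of Y & X | Adj of X & X | Not of test | And of test & test.

Definition Or (t1 t2 : test) : test := Not (And (Not t1) (Not t2)).

Fixpoint holds (A : rel nat) (t : test) (e : env X) (ar : arrays Y) : bool :=
  match t with
  | Get y x => ar y (e x)
  | Adj x x' => A (e x) (e x')
  | Not t => ~~ holds A t e ar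
  | And t1 t2 => holds A t1 e ar && holds A t2 e ar
  end.

Fixpoint ite (t : test) (c1 c2 : cmd X Y) : cmd X Y :=
  match t with
  | Get y x => IfGet y x c1 c2
  | Adj x x' => IfAdj x x' c1 c2
  | Not t => ite t c2 c1
  | And t1 t2 => ite t1 (ite t2 c1 c2) c2
  end.

Definition assign (y : Y) (x : X) (t : test) : cmd X Y :=
  ite t (Set_ y x true) (Set_ y x false).

Fixpoint writes (c : cmd X Y) (y : Y) : bool :=
  match c with
  | Skip => false
  | Set_ y' _ _ => y == y'
  | IfGet _ _ c1 c2 | IfAdj _ _ c1 c2 | Seq c1 c2 => writes c1 y || writes c2 y
  | For _ c => writes c y
  end.

Lemma writes_seq c1 c2 y : writes (Seq c1 c2) y = writes c1 y || writes c2 y.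
Proof. by []. Qed.

Lemma writes_for x c y : writes (For x c) y = writes c y.
Proof. by []. Qed.

Lemma writes_ite t c1 c2 y : writes (ite t c1 c2) y = writes c1 y || writes c2 y.
Proof.
elim: t c1 c2 => [y' x|x x'|t IH|t1 IH1 t2 IH2] c1 c2 //=; first by rewrite IH orbC.
by rewrite IH1 IH2 -orbA orbb.
Qed.

Lemma writes_assign y x t y' : writes (assign y x t) y' = (y' == y).
Proof. by rewrite writes_ite /= orbb. Qed.

Section Semantics.
Variables (n : nat) (A : rel nat).

Lemma eval_ite t c1 c2 e ar :
  eval n A (ite t c1 c2) e ar =
  if holds A t e ar then eval n A c1 e ar else eval n A c2 e ar.
Proof.
elim: t c1 c2 => [y x|x x'|t IH|t1 IH1 t2 IH2] c1 c2 //=; first by rewrite IH; case: ifP.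
by rewrite IH1; case: ifP => // _; rewrite IH2.
Qed.

Lemma eval_assign y x t e ar :
  eval n A (assign y x t) e ar = store ar y (e x) (holds A t e ar).
Proof. by rewrite eval_ite; case: ifP. Qed.

Lemma eval_seq (c1 c2 : cmd X Y) e ar :
  eval n A (Seq c1 c2) e ar = eval n A c2 e (eval n A c1 e ar).
Proof. by []. Qed.

Lemma eval_frame (c : cmd X Y) e ar y : ~~ writes c y -> eval n A c e ar y = ar y.
Proof.
elim: c e ar => [|y' x b|y' x c1 IH1 c2 IH2|x x' c1 IH1 c2 IH2|c1 IH1 c2 IH2|x c IH] e ar //=.
- by rewrite /store /upd => /negbTE->.
- by rewrite negb_or => /andP[/IH1 H1 /IH2 H2]; case: ifP.
- by rewrite negb_or => /andP[/IH1 H1 /IH2 H2]; case: ifP.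
- by rewrite negb_or => /andP[/IH1 H1 /IH2 H2]; rewrite H2 H1.
by move=> /IH H; elim: (iota 0 n) ar => //= i s IHs ar; rewrite IHs H.
Qed.

Lemma eval_for_ind (x : X) c (I : nat -> arrays Y -> Prop) e ar :
  I 0 ar ->
  (forall i ar', i < n -> I i ar' -> I i.+1 (eval n A c (upd e x i) ar')) ->
  I n (eval n A (For x c) e ar).
Proof.
move=> H0 HS /=.
have : forall m i ar', i + m = n -> I i ar' ->
    I n (foldl (fun ar i => eval n A c (upd e x i) ar) ar' (iota i m)).
  elim=> [|m IH] i ar' Hi Hai /=; first by rewrite addn0 in Hi; subst i.
  by apply: IH; [lia | apply: HS => //; lia].
exact.
Qed.

(** For loops that accumulate a conjunction in the flag [y 0]; [I] fixes the data on which [g]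
    depends. *)
Lemma eval_for_all (x : X) c y (I : arrays Y -> Prop) g e ar :
  I ar ->
  (forall i ar', i < n -> I ar' ->
     I (eval n A c (upd e x i) ar') /\
     eval n A c (upd e x i) ar' y 0 = ar' y 0 && g i) ->
  eval n A (For x c) e ar y 0 = ar y 0 && all g (iota 0 n).
Proof.
move=> H0 HS.
have H := @eval_for_ind x c (fun i ar' => I ar' /\ ar' y 0 = ar y 0 && all g (iota 0 i)) e ar.
apply: (proj2 (H _ _)); first by rewrite andbT.
move=> i ar' Hi [Hai Ha]; have [H1 H2] := HS i ar' Hi Hai; split=> //.
by rewrite H2 Ha -addn1 iotaD all_cat /= andbT add0n andbA.
Qed.

Lemma eval_for_map (x : X) c y (I : arrays Y -> Prop) g e ar :
  I ar ->
  (forall i ar', i < n -> I ar' ->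
     I (eval n A c (upd e x i) ar') /\
     eval n A c (upd e x i) ar' y = upd (ar' y) i (g i)) ->
  forall i, i < n -> eval n A (For x c) e ar y i = g i.
Proof.
move=> H0 HS.
have H := @eval_for_ind x c (fun i ar' => I ar' /\ forall j, j < i -> ar' y j = g j) e ar.
apply: (proj2 (H _ _)) => // i ar' Hi [Hai Ha].
have [H1 H2] := HS i ar' Hi Hai; split=> // j Hj.
by rewrite H2 /upd; case: eqP => [->|ne] //; apply: Ha; lia.
Qed.

End Semantics.
End Macros.

(** * The search for a dominating independent set *)

Section Search.
Variables (n : nat) (A : rel nat).

Definition no_nbr (J : pred nat) (u : nat) : bool :=
  all (fun y => ~~ (J y && A u y)) (iota 0 n).

(** [E] is the set of forbidden vertices, and [k] vertices have been processed. *)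
Fixpoint greedy (E : pred nat) (k : nat) : pred nat :=
  if k is k'.+1 then upd (greedy E k') k' (no_nbr (greedy E k') k' && ~~ E k')
  else pred0.

Definition dominates (J : pred nat) (v : nat) : bool :=
  all (fun u => ~~ (no_nbr J u && A u v)) (iota 0 n).

(* The pair (a, b) stands for an edge; pairs with a = 0 change nothing, so that
   fewer than r corrections are covered too. *)
Fixpoint refuted (r : nat) (E : pred nat) (v : nat) : bool :=
  if r is r'.+1 then
    all (fun a => all (fun b =>
      refuted r' (fun u => E u || (u < a) && (A u a || A u b)) v)
      (iota 0 n)) (iota 0 n)
  else ~~ dominates (greedy E n) v.

Lemma greedy_ext E E' k : (forall u, u < k -> E u = E' u) -> greedy E k = greedy E' k.
Proof.
by elim: k => //= k IH HE; rewrite IH ?HE // => u Hu; apply: HE; lia.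
Qed.

Lemma refuted_ext r E E' v : (forall u, u < n -> E u = E' u) -> refuted r E v = refuted r E' v.
Proof.
elim: r E E' => [|r IH] E E' HE /=; first by rewrite (greedy_ext HE).
by apply: eq_all => a; apply: eq_all => b; apply: IH => u /HE ->.
Qed.

End Search.

(** * The search as a loop program *)

Section Program.
Variable p : nat.

Definition var : finType := ('I_p.+1 * bool + bool * bool)%type.
Definition xa (r : nat) : var := inl (inord r, false).
Definition xb (r : nat) : var := inl (inord r, true).
Definition xv : var := inr (false, false).
Definition xu : var := inr (false, true).
Definition xy : var := inr (true, false).
Definition xz : var := inr (true, true).

Definition arr : finType := ('I_p.+1 + bool * bool * bool)%type.
(** Every level of the search has its own forbidden set, so that inner levels preserve it for later
    rounds of the outer loops. *)
Definition yE (r : nat) : arr := inl (inord r).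
Definition yJ : arr := inr (false, false, false).
Definition yT : arr := inr (false, false, true).
Definition yC : arr := inr (false, true, false).
Definition yD : arr := inr (false, true, true).
Definition yans : arr := inr (true, false, false).

(* The variable xz is never bound, so cell xz of an array is a flag. *)
Definition check_nbrs : cmd var arr :=
  Seq (Set_ yC xz true)
    (For xy (assign yC xz (And (Get yC xz) (Not (And (Get yJ xy) (Adj _ xu xy)))))).

Definition run_greedy : cmd var arr :=
  Seq (For xu (Set_ yJ xu false))
    (For xu (Seq check_nbrs (assign yJ xu (And (Get yC xz) (Not (Get (yE 0) xu)))))).

Definition test_dominates : cmd var arr :=
  Seq (Set_ yD xz true)
    (For xu (Seq check_nbrs
      (assign yD xz (And (Get yD xz) (Not (And (Get yC xz) (Adj _ xu xv))))))).

(** The language cannot compare vertices. Instead [yT] marks the vertex [xa r], and the flag in [yC]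
    is cleared when the loop over [xu] meets the mark; the flag then says that [xu] comes before
    [xa r]. *)
Definition exclude (r : nat) : cmd var arr :=
  Seq (For xu (Set_ yT xu false))
  (Seq (Set_ yT (xa r) true)
  (Seq (Set_ yC xz true)
  (For xu (Seq (ite (Get yT xu) (Set_ yC xz false) (@Skip var arr))
    (assign (yE r) xu
      (Or (Get (yE r.+1) xu)
        (And (Get yC xz) (Or (Adj _ xu (xa r)) (Adj _ xu (xb r)))))))))).

Fixpoint search (r : nat) : cmd var arr :=
  if r is r'.+1 then For (xa r') (For (xb r') (Seq (exclude r') (search r')))
  else Seq run_greedy (Seq test_dominates
         (assign yans xz (And (Get yans xz) (Not (Get yD xz))))).

(** The answer is initialised inside a loop, so it stays false for the empty graph. *)
Definition main : cmd var arr :=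
  Seq (For xu (Set_ yans xz true))
    (For xv (Seq (For xu (assign (yE p) xu (Adj _ xu xv)))
            (Seq (Set_ (yE p) xv true) (search p)))).

Lemma searchS r : search r.+1 = For (xa r) (For (xb r) (Seq (exclude r) (search r))).
Proof. by []. Qed.

Lemma inord_eqF k r : k <= p -> r <= p -> k != r -> (inord k == inord r :> 'I_p.+1) = false.
Proof. by move=> Hk Hr /negbTE <-; rewrite -val_eqE /= !inordK. Qed.

Lemma yE_neq r r' : r <= p -> r' <= p -> r != r' -> yE r != yE r'.
Proof.
by move=> Hr Hr' ne; apply/eqP => -[/eqP]; rewrite inord_eqF.
Qed.

Lemma well_scoped_search (B : pred var) r : r <= p ->
  (forall k, k < r -> ~~ B (xa k) /\ ~~ B (xb k)) ->
  ~~ B xu -> ~~ B xy -> B xv -> well_scoped B (search r).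
Proof.
elim: r B => [|r IH] B Hr HB Hu Hy Hv.
  by rewrite /= /upd /= (negbTE Hu) (negbTE Hy) Hv.
have [Ha Hb] := HB r (ltnSn r).
have ab : (xb r == xa r) = false by apply/eqP => -[].
rewrite searchS /= {1 2}/upd ab Ha Hb /=.
set B' := upd _ (xb r) true.
have Ba : B' (xa r) by rewrite /B' /upd eqxx if_same.
have Bb : B' (xb r) by rewrite /B' /upd eqxx.
have Bu : B' xu = false by rewrite /B' /upd /= (negbTE Hu).
have By : B' xy = false by rewrite /B' /upd /= (negbTE Hy).
have Bv : B' xv by rewrite /B' /upd.
apply/andP; split; first by do !(apply/andP; split); rewrite ?Hu ?Bu ?Ba ?Bb.
apply: (IH B'); [exact: ltnW | | by rewrite Bu | by rewrite By | exact: Bv].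
move=> k Hk; have [Hka Hkb] := HB k (ltnW Hk).
have kr : (inord k == inord r :> 'I_p.+1) = false.
  by apply: inord_eqF (ltnW Hr) _; [exact: leq_trans (ltnW Hk) (ltnW Hr) | rewrite ltn_eqF].
have E b b' : (inl (inord k, b) == inl (inord r, b') :> var) = false.
  by apply/eqP => -[/eqP]; rewrite kr.
by rewrite /B' /upd /xa /xb !E.
Qed.

Lemma well_scoped_main : well_scoped pred0 main.
Proof.
rewrite /= /upd /=; apply: well_scoped_search => // k _.
Qed.

Variables (n : nat) (A : rel nat).

Lemma eval_check_nbrs e ar : e xz = 0 ->
  eval n A check_nbrs e ar yC 0 = no_nbr n A (ar yJ) (e xu).
Proof.
move=> Hz; rewrite eval_seq (@eval_for_all _ _ n A xy _ yC (fun ar' => ar' yJ = ar yJ)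
    (fun y => ~~ (ar yJ y && A (e xu) y))) //.
  by rewrite /= /store /upd /= Hz.
move=> i ar' Hi HJ; split; first by rewrite eval_frame ?writes_assign.
by rewrite eval_assign /= /store /upd /= Hz HJ.
Qed.

Lemma eval_reset (y : arr) e ar i : i < n -> eval n A (For xu (Set_ y xu false)) e ar y i = false.
Proof.
move=> Hi; rewrite (@eval_for_map _ _ n A xu _ y xpredT (fun=> false)) // => k ar' Hk _.
by split=> //; rewrite /= /store /upd /= eqxx.
Qed.

Lemma writes_check_nbrs y : writes check_nbrs y = (y == yC).
Proof. by rewrite writes_seq writes_for writes_assign orbb. Qed.

Lemma eval_run_greedy e ar : e xz = 0 ->
  forall i, i < n -> eval n A run_greedy e ar yJ i = greedy n A (ar (yE 0)) n i.
Proof.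
move=> Hz; rewrite eval_seq; set ar1 := eval n A (For _ _) e ar.
set c := Seq check_nbrs _.
have H := @eval_for_ind _ _ n A xu c (fun k ar' => ar' (yE 0) = ar (yE 0) /\
  forall i, i < n -> ar' yJ i = greedy n A (ar (yE 0)) k i) e ar1.
apply: (proj2 (H _ _)) => [|k ar' Hk [HE HJ]].
  split; first by rewrite /ar1 eval_frame.
  by move=> i Hi; rewrite /ar1 eval_reset.
split; first by rewrite eval_frame.
rewrite /c eval_seq; set ar2 := eval n A check_nbrs _ ar'.
have C2 : ar2 yC 0 = no_nbr n A (greedy n A (ar (yE 0)) k) k.
  rewrite /ar2 eval_check_nbrs // /upd eqxx; apply: eq_in_all => y.
  by rewrite mem_iota => /andP[_ Hy]; rewrite HJ.
have F2 y : y != yC -> ar2 y = ar' y.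
  by move=> Hy; rewrite /ar2 eval_frame // writes_check_nbrs.
move=> i Hi; rewrite eval_assign /= /store /upd /=.
case: eqP => _; last by rewrite F2 // HJ.
by rewrite Hz C2 F2 // HE.
Qed.

Lemma eval_test_dominates e ar : e xz = 0 ->
  eval n A test_dominates e ar yD 0 = dominates n A (ar yJ) (e xv).
Proof.
move=> Hz; rewrite eval_seq.
rewrite (@eval_for_all _ _ n A xu _ yD (fun ar' => ar' yJ = ar yJ) (fun u => ~~ (no_nbr n A
    (ar yJ) u && A u (e xv)))) //.
  by rewrite /= /store /upd /= Hz.
move=> i ar' Hi HJ; split.
  by rewrite eval_frame.
rewrite eval_seq eval_assign; set ar2 := eval n A check_nbrs _ ar'.
have C2 : ar2 yC 0 = no_nbr n A (ar yJ) i by rewrite /ar2 eval_check_nbrs // HJ.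
have D2 : ar2 yD = ar' yD by rewrite /ar2 eval_frame.
by rewrite /= /store /upd /= Hz C2 D2.
Qed.

Lemma eval_leaf e ar : e xz = 0 ->
  eval n A (search 0) e ar yans 0 = ar yans 0 && ~~ dominates n A (greedy n A (ar (yE 0)) n)
      (e xv).
Proof.
move=> Hz; rewrite /search 2!eval_seq eval_assign; set ar1 := eval n A run_greedy e ar.
set ar2 := eval n A test_dominates e ar1.
have -> : ar yans = ar2 yans by rewrite /ar2 /ar1 !eval_frame.
have D2 : ar2 yD 0 = dominates n A (ar1 yJ) (e xv) by apply: eval_test_dominates.
rewrite /= /store /upd /= Hz D2; congr (_ && ~~ _).
have HJ i : i < n -> ar1 yJ i = greedy n A (ar (yE 0)) n i by apply: eval_run_greedy.
have nn u : no_nbr n A (ar1 yJ) u = no_nbr n A (greedy n A (ar (yE 0)) n) u.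
  by apply: eq_in_all => y; rewrite mem_iota => /andP[_ Hy]; rewrite HJ.
by apply: eq_all => u; rewrite nn.
Qed.

Lemma writes_exclude r y :
  writes (exclude r) y = [|| y == yT, y == yC | y == yE r].
Proof.
rewrite /exclude !(writes_seq, writes_for, writes_assign, writes_ite) /= !orbF.
by do 3![case: (y == _)].
Qed.

Lemma eval_exclude r e ar i : e xz = 0 -> r < p -> i < n ->
  eval n A (exclude r) e ar (yE r) i =
  ar (yE r.+1) i || (i < e (xa r)) && (A i (e (xa r)) || A i (e (xb r))).
Proof.
move=> Hz Hr Hi; rewrite /exclude 3!eval_seq.
set ar1 := eval n A (Set_ yC xz true) _ _; set c := Seq _ _.
have T1 j : j < n -> ar1 yT j = (j == e (xa r)).
  move=> Hj; rewrite /ar1 /= /store /upd /=; case: eqP => // _.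
  exact: (eval_reset yT).
have C1 : ar1 yC 0 by rewrite /ar1 /= /store /upd /= Hz.
have E1 : ar1 (yE r.+1) = ar (yE r.+1) by rewrite /ar1 !eval_frame.
have neq : yE r.+1 != yE r by apply: yE_neq; lia.
(* Before round [k] the flag says that [xa r] has not been met, hence [k <= e (xa r)]; once round
   [k] has tested the mark, the inequality is strict. *)
have H := @eval_for_ind _ _ n A xu c (fun k ar' =>
  [/\ ar' yT = ar1 yT, ar' (yE r.+1) = ar (yE r.+1), ar' yC 0 = (k <= e (xa r)) &
   forall j, j < k -> ar' (yE r) j =
     ar (yE r.+1) j || (j < e (xa r)) && (A j (e (xa r)) || A j (e (xb r)))]) e ar1.
have [||_ _ _] := H _ _; last exact.
  by split.
move=> k ar' Hk [HT HE HC HJ]; rewrite /c eval_seq.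
set ar2 := eval n A (ite _ _ _) _ ar'.
have C2 : ar2 yC 0 = (k < e (xa r)).
  rewrite /ar2 eval_ite /= /upd /= HT T1 //; case: eqP => [->|/eqP ne].
    by rewrite /store /upd /= Hz ltnn.
  by rewrite HC ltn_neqAle ne.
have F2 y : y != yC -> ar2 y = ar' y.
  by move=> Hy; rewrite /ar2 eval_frame // writes_ite /= orbF.
split.
- by rewrite eval_frame ?writes_assign // F2.
- by rewrite eval_frame ?writes_assign // F2.
- by rewrite eval_frame ?writes_assign.
move=> j Hj; rewrite eval_assign /= /store /upd /= eqxx.
case: eqP => [->|ne]; last by rewrite F2 // HJ //; lia.
by rewrite Hz C2 F2 // HE !negb_and !negbK negb_or !negbK.
Qed.

Lemma writes_search_E r r' : r <= r' <= p -> writes (search r) (yE r') = false.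
Proof.
elim: r => [|r IH] Hr; first by [].
rewrite searchS !writes_for writes_seq writes_exclude IH; last lia.
by rewrite orbF /= (negbTE (yE_neq _ _ _)) //; lia.
Qed.

Lemma eval_search r e ar : e xz = 0 -> r <= p ->
  eval n A (search r) e ar yans 0 = ar yans 0 && refuted n A r (ar (yE r)) (e xv).
Proof.
elim: r e ar => [|r IH] e ar Hz Hr; first exact: eval_leaf.
have wE : writes (Seq (exclude r) (search r)) (yE r.+1) = false.
  rewrite writes_seq writes_exclude writes_search_E; last lia.
  by rewrite orbF /= (negbTE (yE_neq _ _ _)) //; lia.
rewrite searchS (@eval_for_all _ _ n A (xa r) _ yans (fun ar' => ar' (yE r.+1) = ar (yE r.+1))
  (fun a => all (fun b => refuted n A r (fun u => ar (yE r.+1) u || (u < a) &&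
      (A u a || A u b)) (e xv)) (iota 0 n))) //.
move=> a ar' Ha HE; split; first by rewrite eval_frame // writes_for wE.
rewrite (@eval_for_all _ _ n A (xb r) _ yans (fun ar' => ar' (yE r.+1) = ar (yE r.+1))
  (fun b => refuted n A r (fun u => ar (yE r.+1) u || (u < a) && (A u a || A u b)) (e xv))) //.
move=> b ar2 Hb HE2; split; first by rewrite eval_frame // wE.
rewrite eval_seq IH; [|by [] | lia].
rewrite eval_frame ?writes_exclude //; congr (_ && _).
apply: refuted_ext => u Hu; rewrite eval_exclude // HE2.
by rewrite /upd !eqxx (_ : (xa r == xb r) = false) ?eqxx //; apply/eqP => -[].
Qed.

Lemma eval_main e ar : e xz = 0 -> ar yans 0 = false ->
  eval n A main e ar yans 0 =
  (0 < n) && all (fun v => refuted n A p (fun u => A u v || (u == v)) v) (iota 0 n).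
Proof.
move=> Hz Ha; rewrite eval_seq; set ar1 := eval n A (For _ _) e ar.
have Ha1 : ar1 yans 0 = (0 < n).
  apply: (@eval_for_ind _ _ n A xu (Set_ yans xz true) (fun k ar' => ar' yans 0 =
      (0 < k)) e ar Ha).
  by move=> i ar' _ _; rewrite /= /store /upd /= Hz.
rewrite (@eval_for_all _ _ n A xv _ yans xpredT (fun v => refuted n A p (fun u => A u v ||
    (u == v)) v)) ?Ha1 //.
move=> v ar' Hv _; split=> //.
rewrite 2!eval_seq; set ar2 := eval n A (For xu _) _ ar'.
have E2 u : u < n -> ar2 (yE p) u = A u v.
  move=> Hu; rewrite /ar2 (@eval_for_map _ _ n A xu _ (yE p) xpredT
      (fun u => A u v)) // => k ar3 Hk _.
  by split=> //; rewrite eval_assign /= /store /upd /= eqxx.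
rewrite eval_search // eval_frame // {1}/ar2 eval_frame ?writes_for ?writes_assign //.
congr (_ && _); rewrite {2}/upd /=; apply: refuted_ext => u Hu.
by rewrite /= /store /upd /= !eqxx; case: eqP => [->|_]; rewrite ?orbT ?orbF ?E2.
Qed.

End Program.

(** * Correctness of the search *)

Lemma greedy_stable n A (E : pred nat) k u : u < k -> greedy n A E k u = greedy n A E u.+1 u.
Proof.
elim: k => // k IH Hk; rewrite [LHS]/= /upd; case: eqP => [->|ne]; last by apply: IH; lia.
by rewrite /= /upd eqxx.
Qed.

Lemma greedy_spec n A (E : pred nat) k u : u < k ->
  greedy n A E k u = no_nbr n A (greedy n A E u) u && ~~ E u.
Proof. by move=> Hu; rewrite greedy_stable //= /upd eqxx. Qed.

(** Corrections only enlarge the forbidden set, so a success is genuine whichever pairs led to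
    it. *)
Lemma refuted_sound n A r (E : pred nat) v : ~~ refuted n A r E v ->
  exists2 E' : pred nat, (forall u, E u -> E' u) & dominates n A (greedy n A E' n) v.
Proof.
elim: r E => [|r IH] E /=; first by rewrite negbK; exists E.
case/allPn => a _ /allPn[b _ /IH[E' HE HD]]; exists E' => // u Hu.
by apply: HE; rewrite Hu.
Qed.

Section Graph.
Variable G : graph.
Let V := vertex G.
Let n := #|V|.
Implicit Types (v w x y z : V) (E : pred nat).

Definition rank x : nat := enum_rank x.

Lemma rank_lt x : rank x < n.
Proof. exact: ltn_ord. Qed.

Lemma rank_inj : injective rank.
Proof. by move=> x y /ord_inj /enum_rank_inj. Qed.

Lemma rank_surj i : i < n -> exists x, i = rank x.
Proof. by move=> Hi; exists (enum_val (Ordinal Hi)); rewrite /rank enum_valK. Qed.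

Lemma all_rank (P : pred nat) : all P (iota 0 n) = [forall x, P (rank x)].
Proof.
apply/allP/forallP => [H x|H i]; first by apply: H; rewrite mem_iota rank_lt.
by rewrite mem_iota => /rank_surj[x ->].
Qed.

Variable A : rel nat.
Hypothesis A_rank : forall x y, A (rank x) (rank y) = adj x y.

Definition closed_nbhd v : pred nat := fun u => A u (rank v) || (u == rank v).

(** A greedy set is independent, since the later of two adjacent members would have been rejected,
    and it avoids the forbidden closed neighbourhood. *)
Lemma unrefuted_dominator r v : ~~ refuted n A r (closed_nbhd v) (rank v) ->
  exists I, dominator v I.
Proof.
case/refuted_sound => E HE; rewrite /dominates all_rank => /forallP dom.
have spec x : greedy n A E n (rank x) -> ~~ E (rank x).
  by rewrite greedy_spec ?rank_lt // => /andP[].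
have lt_indep x y : rank x < rank y -> greedy n A E n (rank x) -> greedy n A E n (rank y) ->
    ~~ adj y x.
  move=> xy; rewrite greedy_stable ?rank_lt // => Hx.
  rewrite greedy_spec ?rank_lt // /no_nbr all_rank => /andP[/forallP/(_ x)].
  by rewrite A_rank greedy_stable // Hx.
exists [set x | greedy n A E n (rank x)]; split.
- apply/independentP => x y; rewrite !inE => Hx Hy.
  have [xy|xy|/rank_inj->] := ltngtP (rank x) (rank y); last by rewrite adj_irr.
    by rewrite adj_sym lt_indep.
  exact: lt_indep.
- rewrite inE; apply/negP => /spec; rewrite HE //; by rewrite /closed_nbhd eqxx orbT.
- move=> x; rewrite inE => /spec; apply: contra => vx; apply: HE.
  by rewrite /closed_nbhd A_rank adj_sym vx.
move=> w vw; have := dom w; rewrite A_rank adj_sym vw andbT /no_nbr all_rank.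
case/forallPn => x; rewrite A_rank negbK => /andP[Hx wx].
by exists x => //; rewrite inE.
Qed.

(** * Greedy errors and induced matchings *)

Section Maximal.
Variables (v0 : V) (J : {set V}).
Hypothesis J_indep : independent J.
Hypothesis J_dom : forall w, adj v0 w -> exists2 x, x \in J & adj w x.

Let Jadj x y : x \in J -> y \in J -> adj x y = false.
Proof. by move=> Hx Hy; apply/negbTE; move/independentP: J_indep; apply. Qed.

(** Since [J] is independent, this makes it a maximal independent set of the graph outside [E]. *)
Definition fits E : Prop :=
  (forall x, x \in J -> ~~ E (rank x)) /\
  (forall x, x \notin J -> ~~ E (rank x) -> exists2 y, y \in J & adj x y).

(* The greedy algorithm errs on w: it meets w before v, the first neighbour of
   w in J. *)
Definition bad E (e : V * V) : bool :=
  let: (w, v) := e in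
  [&& w \notin J, ~~ E (rank w), v \in J, adj w v, rank w < rank v &
      [forall y in J, adj w y ==> (rank v <= rank y)]].

(** Without errors [J] obeys the greedy rule: an allowed vertex outside [J] has a neighbour in [J],
    and the first such neighbour comes before it. *)
Lemma no_bad_greedy E : fits E -> (forall e, ~~ bad E e) ->
  forall x, greedy n A E n (rank x) = (x \in J).
Proof.
move=> [EJ maxJ] nb.
have inJ x : (x \in J) = ~~ E (rank x) && [forall y in J, (rank y < rank x) ==> ~~ adj x y].
  apply/idP/andP => [Hx|[Ex /forallP first_x]].
    by split; [exact: EJ | apply/forallP => y; apply/implyP => Hy; rewrite Jadj // implybT].
  apply: contraT => xJ; have [y0 Hy0 xy0] := maxJ x xJ Ex.
  have P0 : (y0 \in J) && adj x y0 by rewrite Hy0.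
  case: (@arg_minnP _ y0 (fun y => (y \in J) && adj x y) rank P0) => y /andP[Hy xy] min_y.
  suff : bad E (x, y) by rewrite (negbTE (nb (x, y))).
  apply/and5P; split=> //; apply/andP; split.
    have [yx|//|/rank_inj xEy] := ltngtP (rank y) (rank x).
      by have := first_x y; rewrite Hy yx xy.
    by rewrite -xEy Hy in xJ.
  apply/forallP => z; apply/implyP => Hz; apply/implyP => xz; apply: min_y.
  by rewrite Hz.
have step k x : greedy n A E k (rank x) = (rank x < k) && (x \in J).
  elim: k x => // k IH x /=; rewrite /upd; case: eqP => [xk|ne].
    subst k; rewrite ltnSn inJ andbC /no_nbr all_rank /=; congr (_ && _); apply: eq_forallb => y.
    by rewrite A_rank IH; case: (y \in J); case: (_ < _); case: (adj x y).
  by rewrite IH; congr (_ && _); lia.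
by move=> x; rewrite step rank_lt.
Qed.

Lemma no_bad_unrefuted r E : fits E -> (forall e, ~~ bad E e) ->
  ~~ refuted n A r E (rank v0).
Proof.
move=> fE nb; elim: r => [|r IH] /=.
  have gJ := no_bad_greedy fE nb; rewrite negbK /dominates all_rank; apply/forallP => w.
  rewrite A_rank; apply/negP => /andP[nw]; rewrite adj_sym => /J_dom[x Hx wx].
  by move: nw; rewrite /no_nbr all_rank => /forallP/(_ x); rewrite gJ Hx A_rank wx.
have n0 : 0 < n by apply: leq_ltn_trans (rank_lt v0).
apply/allPn; exists 0; first by rewrite mem_iota.
apply/allPn; exists 0; first by rewrite mem_iota.
by rewrite (@refuted_ext _ _ _ _ E) // => u _; rewrite orbF.
Qed.

Lemma induced_matching_add (M : {set {set V}}) w v : induced_matching M -> adj w v ->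
  (forall f z, f \in M -> z \in f -> [/\ z != w, z != v, ~~ adj z w & ~~ adj z v]) ->
  induced_matching ([set w; v] |: M) /\ #|[set w; v] |: M| = #|M|.+1.
Proof.
move=> /andP[ME /forallP indM] wv sep.
have wvM : [set w; v] \notin M.
  by apply/negP => /sep/(_ (set21 _ _))[]; rewrite eqxx.
split; last by rewrite cardsU1 wvM.
apply/andP; split; first by rewrite subUset ME andbT sub1set; apply/in_edges; exists w, v.
have far f z y : f \in M -> z \in f -> y \in [set w; v] -> (z != y) && ~~ adj z y.
  by move=> Hf /(sep f z Hf)[? ? ? ?] /set2P[]->; apply/andP.
apply/forallP => e; apply/implyP => He; apply/forallP => f; apply/implyP => Hf;
    apply/implyP => ef.
have [eM|] := boolP (e \in M); last first.
  move: He ef; rewrite in_setU1 => /orP[/eqP->|->//] ef _.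
  have fM : f \in M by move: Hf; rewrite in_setU1 eq_sym (negbTE ef).
  apply/andP; split.
    rewrite disjoint_sym disjoints_subset; apply/subsetP => z zf; rewrite inE; apply/negP => ze.
    by have := far f z z fM zf ze; rewrite eqxx.
  apply/forallP => x; apply/implyP => xe; apply/forallP => y; apply/implyP => yf.
  by rewrite adj_sym; case/andP: (far f y x fM yf xe).
have [fM|] := boolP (f \in M).
  by have := indM e; rewrite eM => /forallP/(_ f); rewrite fM ef.
move: Hf; rewrite in_setU1 => /orP[/eqP->|->//] _.
apply/andP; split.
  by rewrite disjoints_subset; apply/subsetP => z ze; rewrite inE; apply/negP => zf;
      have := far e z z eM ze zf; rewrite eqxx.
apply/forallP => x; apply/implyP => xe; apply/forallP => y; apply/implyP => yf.
by case/andP: (far e x y eM xe yf).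
Qed.

(** [M] collects the edges of the corrections made so far and [r] more are available. The last
    hypothesis keeps all remaining errors apart from [M]. *)
Lemma fits_unrefuted r E (M : {set {set V}}) :
  fits E -> induced_matching M -> max_induced_matching G <= #|M| + r ->
  (forall w v, bad E (w, v) -> forall f z, f \in M -> z \in f ->
     [/\ z != w, z != v, ~~ adj z w & ~~ adj z v]) ->
  ~~ refuted n A r E (rank v0).
Proof.
elim: r E M => [|r IH] E M fE indM maxM sep.
  (* With no correction left, a further error would give an induced matching larger than the
     maximum. *)
  apply: no_bad_unrefuted => // -[w v]; apply/negP => bwv.
  have [_ _ _ wv _] := and5P bwv; have [indM' cM'] := induced_matching_add indM wv (sep w v bwv).
  have : #|[set w; v] |: M| <= #|M| + 0.
    apply: leq_trans maxM; exact: (@leq_bigmax_cond _ _ (fun M : {set {set vertex G}} => #|M|)).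
  by rewrite cM' addn0 ltnn.
have [/existsP[e0 be0]|/existsPn] := boolP [exists e, bad E e]; last exact: no_bad_unrefuted.
(* The error with the latest [v] is corrected. *)
case: (@arg_maxnP _ e0 (bad E) (fun e => rank e.2) be0) => -[w v] bwv max_v.
have [wJ Ew vJ wv /andP[lt_wv /forallP first_v]] := and5P bwv.
have [indM' cM'] := induced_matching_add indM wv (sep w v bwv).
have [EJ maxJ] := fE.
apply/allPn; exists (rank v); first by rewrite mem_iota rank_lt.
apply/allPn; exists (rank w); first by rewrite mem_iota rank_lt.
apply: (IH _ ([set w; v] |: M)) => //.
(* No vertex of [J] becomes forbidden: it is not adjacent to [v], and a neighbour of [w] in [J] does
   not precede [v]. *)
- split=> [x xJ|x xJ]; last by rewrite negb_or => /andP[Ex _]; apply: maxJ.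
  rewrite negb_or EJ //= !A_rank (Jadj xJ vJ) /=; apply/negP => /andP[xv xw].
  by have := first_v x; rewrite xJ adj_sym xw leqNgt xv.
- by rewrite cM' addSnnS.
move=> w' v' /and5P[w'J]; rewrite negb_or => /andP[Ew' nE] v'J wv' /andP[lt_wv' first_v'].
(* A remaining error was one before, so the choice of [v] gives [v'] at or before [v] and [w']
   strictly before [v]. As [w'] is still allowed, it is adjacent to neither [v] nor [w]. *)
have b' : bad E (w', v') by apply/and5P; split=> //; apply/andP.
have le_v : rank v' <= rank v := max_v _ b'.
have lt_w'v : rank w' < rank v by apply: leq_trans lt_wv' le_v.
move: nE; rewrite lt_w'v /= !A_rank negb_or => /andP[nw'v nw'w] f z.
have nv'v : v' != v by apply: contraNneq nw'v => <-.
have nwv' : w != v' by apply: contraNneq wJ => ->.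
have nvw' : v != w' by apply: contraNneq w'J => <-.
have nww' : w != w' by apply: contraNneq nw'v => <-.
rewrite in_setU1 => /orP[/eqP->|fM]; last exact: sep b' f z fM.
case/set2P=> ->; split=> //.
- by rewrite adj_sym.
(* If [w] were adjacent to [v'], then [v], its first neighbour in [J], would not come after [v'],
   which forces [v' = v]. *)
- apply/negP => wv2; have := first_v v'; rewrite v'J wv2 /= => le_v'.
  by move/eqP: nv'v; apply; apply: rank_inj; apply/eqP; rewrite eqn_leq le_v.
- by rewrite eq_sym.
- by rewrite adj_sym.
by rewrite Jadj.
Qed.

End Maximal.

(** Enlarging [I] to a maximal independent set off the closed neighbourhood of [v] preserves
    domination. Starting from the empty matching, [p] corrections suffice. *)
Lemma dominator_unrefuted p v I : max_induced_matching G <= p -> dominator v I ->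
  ~~ refuted n A p (closed_nbhd v) (rank v).
Proof.
move=> maxp [iI vI nI dI].
pose Q S := independent S && [forall x in S, ~~ closed_nbhd v (rank x)].
have QI : Q I.
  rewrite /Q iI; apply/forallP => x; apply/implyP => xI.
  rewrite /closed_nbhd A_rank adj_sym negb_or nI //; apply: contraNneq vI => /rank_inj <-.
  exact: xI.
have [J /maxsetP[/andP[iJ /forallP EJ] maxJ] IJ] := maxset_exists QI.
apply: (@fits_unrefuted v J iJ _ p _ set0) => //.
- by move=> w /dI[x xI wx]; exists x => //; apply: (subsetP IJ).
- split=> [x xJ|x xJ Ex]; first by have := EJ x; rewrite xJ.
  apply/exists_inP; apply: contraT => /exists_inPn nx.
  have QxJ : Q (x |: J).
    apply/andP; split; last first.
      by apply/forallP => y; apply/implyP => /setU1P[->//|yJ]; have := EJ y; rewrite yJ.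
    apply/independentP => y z /setU1P[->|yJ] /setU1P[->|zJ]; rewrite ?adj_irr ?nx //.
      by rewrite adj_sym nx.
    by move/independentP: iJ; apply.
  by rewrite -(maxJ _ QxJ (subsetUr _ _)) setU11 in xJ.
- by apply/andP; split; [rewrite sub0set | apply/forallP => e; rewrite inE].
- by rewrite cards0.
by move=> w v' _ f z; rewrite inE.
Qed.

End Graph.

(** * The decision procedure for encoded graphs *)

Lemma nth_flatten_map (T S : Type) (x0 : S) (t0 : T) (f : T -> seq S) (m : nat) (s : seq T) i j :
  (forall t, size (f t) = m) -> i < size s -> j < m ->
  nth x0 (flatten (map f s)) (i * m + j) = nth x0 (f (nth t0 s i)) j.
Proof.
move=> Hf; elim: s i => // t s IH [|i] Hi Hj /=; rewrite nth_cat Hf.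
  by rewrite Hj.
by rewrite mulSn -addnA ltnNge leq_addr /= addKn IH.
Qed.

Theorem theorem6 (p : nat) :
  polytime_decidable encode_graph
    (fun G : graph => is_true (max_induced_matching G <= p))
    unique_key_graph.
Proof.
have [M [a [d HM]]] := loop_machine (yans p) (well_scoped_main p).
exists M, a, d => G maxp; set V := vertex G.
pose mat := [seq adj x y | x <- enum V, y <- enum V].
pose A i j := nth false mat (i * #|V| + j).
have A_rank (x y : V) : A (rank x) (rank y) = adj x y.
  rewrite /A; apply: etrans.
    apply: (@nth_flatten_map _ _ false x (fun x => [seq adj x y | y <- enum V]) #|V|).
    - by move=> t; rewrite size_map -cardE.
    - by rewrite -cardE rank_lt.
    exact: rank_lt.
  by rewrite (nth_map y) -?cardE ?rank_lt // !nth_enum_rank.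
exists (eval #|V| A (main p) (fun=> 0) (fun _ _ => false) (yans p) 0); split.
  apply: answers_within_mono (HM #|V| mat) _.
  apply: leq_trans (leq_addr _ _); rewrite leq_mul2l; apply/orP; right.
  (* The unary prefix and the separator alone have this length, so a bound in [#|V|.+1] is one in
     the input size. *)
  have sz : #|V|.+1 <= size (encode_graph G).
    by rewrite size_cat size_nseq /= addnS ltnS leq_addr.
  by case: (d) => // k; rewrite leq_exp2r.
rewrite eval_main // unique_key_graphP all_rank; split=> [/andP[V0 /forallP ref]|[V0 nd]].
  split=> // v I /(dominator_unrefuted A_rank maxp); rewrite ref; by [].
rewrite V0; apply/forallP => v; apply: contraT => /(unrefuted_dominator A_rank)[I].
by move/nd.
Qed.
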